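(* Let the cost be quadratic, $c(x,y)=\frac12\|x-y\|^2$. Let $\mu_0,\mu_1$ be probability measures on $\mathbb{R}^d$, absolutely continuous with respect to the Lebesgue measure, with finite moments of order $2+\delta$ for some $\delta>0$, and with finite entropy. For $\varepsilon>0$ let $\gamma_\varepsilon$ be the minimizer of the entropic optimal transport problem between $\mu_0$ and $\mu_1$, $OT_\varepsilon$ its value, and let $\gamma_0$ be the optimal transport plan for $\varepsilon=0$, with value $OT_0$. Then, as $\varepsilon\to0^+$, $$(c,\gamma_\varepsilon)-(c,\gamma_0)=\Theta(\varepsilon),\qquad H(\gamma_\varepsilon)=-\frac d2\ln(\varepsilon)+O(1),\qquad OT_\varepsilon=OT_0-\frac{d\varepsilon}{2}\ln(\varepsilon)+O(\varepsilon).$$ More precisely, there exist constants $a,b>0$, depending on $m_{2+\delta}(\mu_i)$, $H(\mu_i)$ $(i=0,1)$ and the dimension $d$, such that, as $\varepsilon\to0^+$ (i.e. for all sufficiently small $\varepsilon>0$), $$a\,\varepsilon\le\int E\,d\gamma_\varepsilon=(c,\gamma_\varepsilon)-(c,\gamma_0)\le b\,\varepsilon,$$ where $E$ is the duality gap function of a pair of Kantorovich potentials.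
   Context: $\Pi(\mu_0,\mu_1)$ is the set of probability measures on $\mathbb{R}^d\times\mathbb{R}^d$ with marginals $\mu_0,\mu_1$. $\mathcal{H}^k$ is the Lebesgue measure on $\mathbb{R}^k$. For a probability measure $\mu$ on $\mathbb{R}^k$ with finite second moment, the entropy is $H(\mu)=H(\mu\mid\mathcal{H}^k)=\int\ln(\mu(x))\,d\mu(x)$ if $\mu$ has density $\mu(x)$, and $+\infty$ otherwise; $H(\gamma_\varepsilon)=H(\gamma_\varepsilon\mid\mathcal{H}^{2d})$. $m_k(\mu)$ is the moment of order $k$ of $\mu$. $(c,\gamma):=\int c\,d\gamma$. For $\varepsilon\geq 0$, $OT_\varepsilon=\inf_{\gamma\in\Pi(\mu_0,\mu_1)}\int c\,d\gamma+\varepsilon H(\gamma\mid\mathcal{H}^{2d})$, where for $\varepsilon=0$ the entropy term is absent; $\gamma_\varepsilon$ denotes a minimizer (unique under the present assumptions). Kantorovich potentials: a pair $(\varphi,\psi)$ of continuous functions that maximizes $\int\varphi\,d\mu_0+\int\psi\,d\mu_1$ over $\varphi\in L^1(\mu_0),\psi\in L^1(\mu_1)$ with $\varphi(x)+\psi(y)\le c(x,y)$ for all $x,y$, and such that $\varphi(x)=\inf_y c(x,y)-\psi(y)$, $\psi(y)=\inf_x c(x,y)-\varphi(x)$. The associated duality gap function is $E(x,y)=c(x,y)-\varphi(x)-\psi(y)$. $f(\varepsilon)=\Theta(g(\varepsilon))$ means that there are constants $0<a\le b$ with $a\,g(\varepsilon)\le f(\varepsilon)\le b\,g(\varepsilon)$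 for all small $\varepsilon>0$. *)

(* Defs.v *)
From HB Require Import structures.
From mathcomp Require Import all_boot all_order all_algebra.
From mathcomp Require Import all_classical all_reals all_analysis.

Set Implicit Arguments.
Unset Strict Implicit.
Unset Printing Implicit Defensive.

Import Order.TTheory GRing.Theory Num.Theory.
Import numFieldNormedType.Exports.

Local Open Scope classical_set_scope.
Local Open Scope ring_scope.
Local Open Scope ereal_scope.
Local Open Scope charge_scope.

(* R^n is 'rV[R]_n, with the topology of the library and the product            *)
(* sigma-algebra (the one generated by the coordinates), which for R realType   *)
(* is the Borel sigma-algebra.                                                  *)
Section measurable_rV.
Context {disp : measure_display} {T : measurableType disp} (n : nat).

Definition rV_coord (i : 'I_n) (v : 'rV[T]_n) : T := v ord0 i.

Let rV_set0 : g_sigma_preimage rV_coord set0.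
Proof. exact: sigma_algebra0. Qed.

Let rV_setC A : g_sigma_preimage rV_coord A -> g_sigma_preimage rV_coord (~` A).
Proof. exact: sigma_algebraC. Qed.

Let rV_bigcup (F : _^nat) : (forall i, g_sigma_preimage rV_coord (F i)) ->
  g_sigma_preimage rV_coord (\bigcup_i (F i)).
Proof. exact: sigma_algebra_bigcup. Qed.

HB.instance Definition _ := @isMeasurable.Build (measure_tuple_display disp)
  'rV[T]_n (g_sigma_preimage rV_coord) rV_set0 rV_setC rV_bigcup.

End measurable_rV.

Lemma measurable_rV_coord (disp : measure_display) (T : measurableType disp)
    (n : nat) (i : 'I_n) : measurable_fun [set: 'rV[T]_n] (rV_coord i).
Proof.
move=> _ Y mY; rewrite setTI; apply: sub_sigma_algebra => /=.
rewrite -bigcup_seq/=; exists i => /=; first by rewrite mem_index_enum.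
by exists Y => //; rewrite setTI.
Qed.

Lemma measurable_fun_rVP (disp disp' : measure_display)
    (S : measurableType disp) (T : measurableType disp') (n : nat)
    (f : S -> 'rV[T]_n) :
  measurable_fun setT f <-> forall i, measurable_fun setT (rV_coord i \o f).
Proof.
split=> [mf i|mf]; first exact: measurableT_comp (measurable_rV_coord i) mf.
suff H : g_sigma_preimage (fun i => rV_coord i \o f) `<=` measurable.
  move=> _ A mA; apply: H; rewrite g_sigma_preimage_comp; exists A => //.
apply: smallest_sub; first exact: sigma_algebra_measurable.
case: n => [|n] in f mf *; first by rewrite big_ord0.
rewrite -bigcup_mkord_ord; apply: bigcup_sub => i Ii.
by move=> A [B mB <-]; exact: mf.
Qed.

(* The library makes m1 \x m2 canonically sigma-finite only when m1 and m2 are   *)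
(* subprobabilities; this copy of m1 \x m2 has the general instance.             *)
Section product_sfm.
Context (disp1 disp2 : measure_display) (T1 : measurableType disp1)
  (T2 : measurableType disp2) (R : realType).
Variables (m1 : {sigma_finite_measure set T1 -> \bar R})
  (m2 : {sigma_finite_measure set T2 -> \bar R}).

Definition product_sfm : set (T1 * T2) -> \bar R := m1 \x m2.

HB.instance Definition _ := Measure.copy product_sfm (m1 \x m2).

Let product_sfm_sigma_finite : sigma_finite setT product_sfm.
Proof.
have /sigma_finiteP[F [TF ndF Foo]] := sigma_finiteT m1.
have /sigma_finiteP[G [TG ndG Goo]] := sigma_finiteT m2.
exists (fun n => F n `*` G n).
  rewrite -setXTT TF TG predeqE => -[x y]; split.
    move=> [/= [n _ Fnx] [k _ Gky]]; exists (maxn n k) => //; split.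
    - by move: x Fnx; exact/subsetPset/ndF/leq_maxl.
    - by move: y Gky; exact/subsetPset/ndG/leq_maxr.
  by move=> [n _ []/= ? ?]; split; exists n.
move=> k; have [? ?] := Foo k; have [? ?] := Goo k.
split; first exact: measurableX.
by rewrite /product_sfm product_measure1E// lte_mul_pinfty// ge0_fin_numE.
Qed.

HB.instance Definition _ := Measure_isSigmaFinite.Build _ _ _ product_sfm
  product_sfm_sigma_finite.

End product_sfm.

Section lebesgue_measure_rV.
Context {R : realType}.
Local Notation RxrV n := (measurableTypeR R * 'rV[R]_n)%type.

Definition rV_cons (n : nat) (p : RxrV n) : 'rV[R]_n.+1 :=
  \row_i if unlift ord0 i is Some j then p.2 ord0 j else p.1.

Definition rV_uncons (n : nat) (v : 'rV[R]_n.+1) : RxrV n :=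
  (v ord0 ord0, \row_j v ord0 (lift ord0 j)).

Lemma rV_cons0 (n : nat) (p : RxrV n) : rV_cons p ord0 ord0 = p.1.
Proof. by rewrite mxE unlift_none. Qed.

Lemma rV_consS (n : nat) (p : RxrV n) (i : 'I_n) :
  rV_cons p ord0 (lift ord0 i) = p.2 ord0 i.
Proof. by rewrite mxE liftK. Qed.

Lemma rV_consK (n : nat) : cancel (@rV_cons n) (@rV_uncons n).
Proof.
move=> [x v]; rewrite /rV_uncons rV_cons0; congr pair.
by apply/rowP => j; rewrite mxE rV_consS.
Qed.

Lemma measurable_rV_cons (n : nat) : measurable_fun setT (@rV_cons n).
Proof.
apply/measurable_fun_rVP => i; rewrite /comp /rV_coord.
case: (unliftP ord0 i) => [j ->|->].
- under eq_fun do rewrite rV_consS.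
  exact: measurableT_comp (measurable_rV_coord j) measurable_snd.
- by under eq_fun do rewrite rV_cons0; exact: measurable_fst.
Qed.

Lemma measurable_rV_uncons (n : nat) : measurable_fun setT (@rV_uncons n).
Proof.
apply/measurable_fun_pairP; split; first exact: measurable_rV_coord.
apply/measurable_fun_rVP => i; rewrite /comp /rV_coord/=.
under eq_fun do rewrite mxE.
exact: measurable_rV_coord.
Qed.

Section lebesgue_rV_step.
Context (n : nat) (m : {sigma_finite_measure set 'rV[R]_n -> \bar R}).

Definition lebesgue_rV_step : set 'rV[R]_n.+1 -> \bar R :=
  pushforward (product_sfm (@lebesgue_measure R) m) (@rV_cons n).

Let step0 : lebesgue_rV_step set0 = 0.
Proof. by rewrite /lebesgue_rV_step /pushforward preimage_set0 measure0. Qed.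

Let step_ge0 A : 0 <= lebesgue_rV_step A.
Proof. by rewrite /lebesgue_rV_step /pushforward; exact: measure_ge0. Qed.

Let step_sigma_additive : semi_sigma_additive lebesgue_rV_step.
Proof.
pose mu : {measure set 'rV[R]_n.+1 -> \bar R} :=
  measure_function_pushforward__canonical__measure_function_Measure
    (product_sfm (@lebesgue_measure R) m) (@measurable_rV_cons n).
exact: (@measure_semi_sigma_additive _ _ _ mu).
Qed.

HB.instance Definition _ := isMeasure.Build _ _ _ lebesgue_rV_step
  step0 step_ge0 step_sigma_additive.

Let step_sigma_finite : sigma_finite setT lebesgue_rV_step.
Proof.
have [F FT Foo] := sigma_finiteT (product_sfm (@lebesgue_measure R) m).
exists (fun k => @rV_uncons n @^-1` F k).
  by rewrite -preimage_bigcup -FT preimage_setT.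
move=> k; have [mF Fk] := Foo k; split.
  by rewrite -[X in measurable X]setTI; exact: measurable_rV_uncons.
rewrite /lebesgue_rV_step /pushforward -comp_preimage.
by rewrite (_ : _ \o _ = id) ?preimage_id//; exact/funext/rV_consK.
Qed.

HB.instance Definition _ := Measure_isSigmaFinite.Build _ _ _ lebesgue_rV_step
  step_sigma_finite.

End lebesgue_rV_step.

Fixpoint lebesgue_rV (n : nat) : {sigma_finite_measure set 'rV[R]_n -> \bar R} :=
  if n is m.+1 then lebesgue_rV_step (lebesgue_rV m) else \d_ (0%R : 'rV[R]_0).

End lebesgue_measure_rV.
Arguments lebesgue_rV R n : clear implicits.

Lemma lebesgue_rV_box (R : realType) (n : nat) (A : 'I_n -> set R) :
  (forall i, measurable (A i)) ->
  lebesgue_rV R n [set v | forall i, A i (v ord0 i)] =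
  \prod_(i < n) lebesgue_measure (A i).
Proof.
elim: n A => [|n IH] A mA.
  by rewrite big_ord0 /= diracE mem_set// => -[].
pose B : set 'rV[R]_n := [set v | forall i, A (lift ord0 i) (v ord0 i)].
have mB : measurable B.
  rewrite (_ : B = \bigcap_(i in [set: 'I_n])
     (@rV_coord _ R n i @^-1` A (lift ord0 i))).
    apply: fin_bigcap_measurable => // i _.
    by rewrite -[X in measurable X]setTI; exact: measurable_rV_coord.
  by apply/seteqP; split => v /= h i; [move=> _|]; exact: h.
have AB : @rV_cons R n @^-1` [set v | forall i, A i (v ord0 i)] = A ord0 `*` B.
  apply/seteqP; split => -[x v] /=.
    move=> h; split; first by have := h ord0; rewrite rV_cons0.
    by move=> i; have := h (lift ord0 i); rewrite rV_consS.
  move=> [h0 h] i; case: (unliftP ord0 i) => [j ->|->].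
    by rewrite rV_consS; exact: h.
  by rewrite rV_cons0.
rewrite big_ord_recl -IH//.
transitivity (product_sfm (@lebesgue_measure R) (lebesgue_rV R n) (A ord0 `*` B)).
  by rewrite -AB.
rewrite /product_sfm product_measure1E//; exact: (mA ord0).
Qed.

Definition enorm (R : realType) (d : nat) (x : 'rV[R]_d) : R :=
  Num.sqrt (\sum_(i < d) x ord0 i ^+ 2)%R.

Definition quadratic_cost (R : realType) (d : nat) (x y : 'rV[R]_d) : R :=
  (2^-1 * enorm (x - y) ^+ 2)%R.

Definition moment (R : realType) (d : nat) (k : R) (mu : probability 'rV[R]_d R)
    : \bar R :=
  \int[mu]_x (enorm x `^ k)%:E.

(* The convention ln 0 = 0 is harmless: the density vanishes only on a          *)
(* mu-null set.                                                                 *)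
Definition entropy (disp : measure_display) (T : measurableType disp)
    (R : realType) (nu : {sigma_finite_measure set T -> \bar R})
    (mu : probability T R) : \bar R :=
  if `[< mu `<< nu >] then
    \int[mu]_x (ln (fine ('d (charge_of_finite_measure mu) '/d nu x)))%:E
  else +oo.

Section entropic_optimal_transport.
Context {R : realType} {d : nat}.
Local Notation E := 'rV[R]_d.
Variables (c : E -> E -> R) (mu0 mu1 : probability E R).

(* R^(2d) is identified with R^d x R^d. *)
Definition lebesgue_rV2 : {sigma_finite_measure set (E * E)%type -> \bar R} :=
  product_sfm (lebesgue_rV R d) (lebesgue_rV R d).

Definition couplings : set (probability (E * E)%type R) :=
  [set gamma | forall A, measurable A ->
    pushforward gamma fst A = mu0 A /\ pushforward gamma snd A = mu1 A].

Definition transport_cost (gamma : probability (E * E)%type R) : \bar R :=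
  \int[gamma]_p (c p.1 p.2)%:E.

(* For eps = 0 the entropy term is absent, since 0 * +oo = 0 in \bar R. *)
Definition eot_functional (eps : R) (gamma : probability (E * E)%type R)
    : \bar R :=
  transport_cost gamma + eps%:E * entropy lebesgue_rV2 gamma.

Definition eot_value (eps : R) : \bar R :=
  ereal_inf (eot_functional eps @` couplings).

Definition eot_minimizer (eps : R) (gamma : probability (E * E)%type R) : Prop :=
  couplings gamma /\ eot_functional eps gamma = eot_value eps.

Definition dual_admissible (phi psi : E -> R) : Prop :=
  [/\ mu0.-integrable setT (EFin \o phi), mu1.-integrable setT (EFin \o psi)
    & forall x y, (phi x + psi y <= c x y)%R].

Definition dual_value (phi psi : E -> R) : \bar R :=
  \int[mu0]_x (phi x)%:E + \int[mu1]_y (psi y)%:E.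

Definition kantorovich_potentials (phi psi : E -> R) : Prop :=
  [/\ continuous phi /\ continuous psi,
      dual_admissible phi psi,
      forall phi' psi', dual_admissible phi' psi' ->
        dual_value phi' psi' <= dual_value phi psi,
      forall x, (phi x)%:E = ereal_inf [set (c x y - psi y)%:E | y in setT]
    & forall y, (psi y)%:E = ereal_inf [set (c x y - phi x)%:E | x in setT]].

Definition duality_gap (phi psi : E -> R) (x y : E) : R :=
  (c x y - phi x - psi y)%R.

End entropic_optimal_transport.
Arguments lebesgue_rV2 R d : clear implicits.

(* f(eps) = Theta(g(eps)) and f(eps) = O(g(eps)) as eps -> 0+, for an           *)
(* extended-real f, which either property forces to be finite for small eps.    *)
Definition is_Theta0 (R : realType) (f : R -> \bar R) (g : R -> R) : Prop :=
  exists a b : R, [/\ (0 < a)%R, (a <= b)%R &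
    \forall eps \near (0:R)^'+, (a * g eps)%:E <= f eps <= (b * g eps)%:E].

Definition is_O0 (R : realType) (f : R -> \bar R) (g : R -> R) : Prop :=
  exists C : R, \forall eps \near (0:R)^'+, `|f eps| <= (C * `|g eps|)%:E.

(* Main.v *)
(* Write s for the suboptimality of a coupling gamma.

   Lower bound: H(gamma) >= - (d/2) ln s - C.  By Kantorovich duality there are
   admissible potentials, with gap E >= 0, such that the integral of E against
   gamma is at most 2 s.  On an antidiagonal {x + y = u}, exchanging partners
   gives E(x, y) + E(x', y') >= |x - x'|^2 (Minty's trick), so that
   exp (- E / s) w(x + y), with w a Gaussian density, has mass O(s^(d/2)); Gibbs'
   inequality against this density is the claim.  It needs no optimal
   potentials, only a small duality defect.

   Upper bound: cut R^d into O(n^d) cells according to the value of x + y, and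
   in each of them replace the optimal plan by the product of its marginals.
   The cost increases by at most the mean of |u - u'|^2 / 8 over pairs
   of values of x + y in the same cell, and the entropy is at most
   H(mu0) + H(mu1) + ln (number of cells).  A moment of order 2 + delta allows
   finitely many cells of size 1/n in this quadratic mean; take n ~ eps^(-1/2).

   For a minimizer, r = s / eps then satisfies r <= D + (d/2) ln r, which bounds r
   from above and, since s >= 0, from below. *)

Require Import Defs.
From HB Require Import structures.
From mathcomp Require Import all_boot all_order all_algebra.
From mathcomp Require Import all_classical all_reals all_analysis.
From mathcomp Require Import measurable_realfun ring lra.

Set Implicit Arguments.
Unset Strict Implicit.
Unset Printing Implicit Defensive.

Import Order.TTheory GRing.Theory Num.Theory.
Import numFieldNormedType.Exports.

Local Open Scope classical_set_scope.
Local Open Scope ring_scope.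
Local Open Scope ereal_scope.

(** * Measures with densities *)

(** The lower entropy bound tolerates a duality defect, so no optimal potentials have to be built.
    Rockafellar's potentials on the support of the optimal plan may be infinite and need not be
    known to be integrable; they are truncated at height [n], and dominated convergence under the
    optimal plan makes the defect small. The same approximate duality shows that given Kantorovich
    potentials have dual value equal to the optimal cost, whence the identity between the integral
    of [E] and the excess cost.

    The product on cells and the cyclic exchange of mass behind cyclical monotonicity are both
    instances of one construction, [resampling].

    The suboptimality [s] of a minimizer might a priori vanish, where [ln s] is meaningless. The
    entropy bound is therefore stated for every [tau >= s], and two choices of [tau] give the two
    rates. Every estimate is explicit in [d], [delta], the moments and the entropies, with no
    compactness argument, which is why [a] and [b] can be fixed before the measures. *)

Section integral_comparison.
Context d (T : measurableType d) (R : realType) (mu : {measure set T -> \bar R}).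

(** By the convention [+oo - +oo = -oo] an undefined integral is infinite, so a real value forces
    both parts to be finite. This is how a finite entropy yields an integrable logarithm. *)
Lemma integrable_of_integral_fin (f : T -> \bar R) (r : R) :
  measurable_fun [set: T] f -> \int[mu]_x f x = r%:E -> mu.-integrable setT f.
Proof.
move=> mf; rewrite integralE => fr; apply/integrableP; split=> //.
apply/abse_integralP => //; rewrite integralE fr //; exact: ltry.
Qed.

(** Subtraction of extended reals is monotone even when a part is infinite, so the entropy of a
    coupling can be compared before it is known to be finite. *)
Lemma ae_le_integral (f g : T -> \bar R) :
  measurable_fun [set: T] f -> measurable_fun [set: T] g ->
  {ae mu, forall x, f x <= g x} -> \int[mu]_x f x <= \int[mu]_x g x.
Proof.
move=> mf mg fg.
rewrite integralE [leRHS]integralE; apply: leeB.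
- apply: ae_ge0_le_integral => //; [exact: measurable_funepos..|].
  by apply: filterS fg => x fgx _; rewrite !funeposE ge_max !le_max fgx lexx orbT.
- apply: ae_ge0_le_integral => //; [exact: measurable_funeneg..|].
  by apply: filterS fg => x fgx _; rewrite !funenegE ge_max !le_max leeN2 fgx lexx orbT.
Qed.

End integral_comparison.

Section density.
Context d (T : measurableType d) (R : realType).

(** The integration formula is inherited from Radon-Nikodym: the derivative of the new measure has
    the same integrals as [g] on all measurable sets, hence equals [g] almost everywhere. *)
Lemma density_measure (mu : {sigma_finite_measure set T -> \bar R})
    (g : T -> \bar R) :
  (forall x, 0 <= g x) -> mu.-integrable setT g ->
  exists nu : {finite_measure set T -> \bar R},
    (forall A, measurable A -> nu A = \int[mu]_(x in A) g x) /\
    (forall f : T -> \bar R, measurable_fun [set: T] f -> (forall x, 0 <= f x) ->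
       \int[nu]_x f x = \int[mu]_x (f x * g x)).
Proof.
move=> g0 ig; have mg := measurable_int _ ig.
pose nu A := \int[mu]_(x in A) g x.
have nu0 : nu set0 = 0 by rewrite /nu integral_set0.
have nu_ge0 A : 0 <= nu A by exact: integral_ge0.
have nu_add : semi_sigma_additive nu.
  move=> F mF tF mUF; rewrite /nu ge0_integral_bigcup//; last first.
    exact: measurable_funTS.
  by apply: is_cvg_ereal_nneg_natsum_cond => n _ _; exact: nu_ge0.
pose nuM := isMeasure.Build _ _ _ nu nu0 nu_ge0 nu_add.
pose nu1 : {measure set T -> \bar R} := HB.pack nu nuM.
have nu1fin : fin_num_fun nu1.
  move=> A mA; rewrite ge0_fin_numE// /nu1/= /nu.
  apply: (@le_lt_trans _ _ (\int[mu]_x g x)).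
    exact: ge0_subset_integral.
  have /integrableP[_] := ig.
  by under eq_integral do rewrite gee0_abs//.
pose nuF := Measure_isFinite.Build _ _ _ nu1 nu1fin.
pose nu2 : {finite_measure set T -> \bar R} := HB.pack nu nuM nuF.
have nu2mu : nu2 `<< mu.
  apply/null_content_dominatesP => A mA A0.
  by rewrite /nu2/= /nu; apply: null_set_integral => //; exact: measurable_funTS.
exists nu2; split => // f mf f0.
rewrite -(Radon_Nikodym_SigmaFinite.change_of_variables nu2mu)//.
apply: ae_eq_integral => //.
- apply: emeasurable_funM => //.
  exact: measurable_int (Radon_Nikodym_SigmaFinite.f_integrable nu2mu).
- exact: emeasurable_funM.
- apply: ae_eqe_mul2l; apply: integral_ae_eq => //.
  + exact: Radon_Nikodym_SigmaFinite.f_integrable.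
  + by move=> E _ mE; rewrite -Radon_Nikodym_SigmaFinite.f_integral.
Qed.

Lemma probability_of_measure (mu : {measure set T -> \bar R}) :
  mu setT = 1 -> exists P : probability T R, forall A, P A = mu A.
Proof.
case: mu => nu nuc nuT.
pose nuP := Measure_isProbability.Build _ _ _ (Measure.Pack nuc) nuT.
pose nuM : {measure set T -> \bar R} := Measure.Pack nuc.
pose P : probability T R := HB.pack (nu : set T -> \bar R) nuc nuP.
by exists P.
Qed.

Lemma finite_measure_of_measure (mu : {measure set T -> \bar R}) :
  mu setT < +oo ->
  exists P : {finite_measure set T -> \bar R}, forall A, P A = mu A.
Proof.
case: mu => nu nuc nuT.
have nufin : fin_num_fun (Measure.Pack nuc).
  move=> A mA; rewrite ge0_fin_numE//; apply: le_lt_trans nuT.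
  by apply: (@le_measure _ _ _ (Measure.Pack nuc)); rewrite ?inE.
pose nuP := Measure_isFinite.Build _ _ _ (Measure.Pack nuc) nufin.
pose P : {finite_measure set T -> \bar R} := HB.pack (nu : set T -> \bar R) nuc nuP.
by exists P.
Qed.

Lemma ge0_integral_product_sfm d' (T' : measurableType d')
    (mu : {sigma_finite_measure set T -> \bar R})
    (nu : {sigma_finite_measure set T' -> \bar R}) (f : T * T' -> \bar R) :
  measurable_fun [set: T * T'] f -> (forall z, 0 <= f z) ->
  \int[product_sfm mu nu]_z f z = \int[mu]_x \int[nu]_y f (x, y).
Proof.
move=> mf f0; transitivity (\int[mu \x nu]_z f z).
  exact: eq_measure_integral.
exact: (@fubini_tonelli1 _ _ _ _ _ mu nu).
Qed.

(** On the set where [g < f], the positive function [f - g] has integral at most 0, so this set is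
    null. *)
Lemma ae_le_of_integral_le (mu : {measure set T -> \bar R}) (f g : T -> R) :
  mu.-integrable setT (EFin \o f) -> mu.-integrable setT (EFin \o g) ->
  (forall A, measurable A -> \int[mu]_(x in A) (f x)%:E <= \int[mu]_(x in A) (g x)%:E) ->
  {ae mu, forall x, (f x <= g x)%R}.
Proof.
move=> fi gi fg.
have mf : measurable_fun [set: T] f by apply/measurable_EFinP; exact: measurable_int fi.
have mg : measurable_fun [set: T] g by apply/measurable_EFinP; exact: measurable_int gi.
pose B := [set x | (g x < f x)%R].
have mB : measurable B.
  have := measurable_lte measurableT (measurable_int _ gi) (measurable_int _ fi).
  by rewrite setTI.
have : \int[mu]_(x in B) `|(f x - g x)%:E| = 0.
  apply/eqP; rewrite eq_le integral_ge0 ?andbT//.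
  rewrite (eq_integral (fun x => (f x)%:E - (g x)%:E)); last first.
    move=> x /[!inE] xB; rewrite gee0_abs ?lee_fin ?subr_ge0 ?(ltW xB)//.
  rewrite integralB//; [|exact: integrableS fi|exact: integrableS gi].
  by rewrite leeBlDr ?add0e ?fg// integrable_fin_num//; exact: integrableS gi.
move=> /(ae_eq_integral_abs mu mB).
have mfg : measurable_fun B (fun x => (f x - g x)%:E).
  by apply: measurable_funTS; apply/measurable_EFinP; exact: measurable_funB.
move=> /(_ mfg); apply: filterS => x fgx.
rewrite leNgt; apply/negP => xB; move: (fgx xB) => /eqP.
by rewrite eqe subr_eq0 gt_eqF.
Qed.

End density.

(** * Lebesgue measure on row vectors *)

Section rV_measurability.
Context {R : realType} (n : nat).
Local Notation E := 'rV[R]_n.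

Lemma measurable_rV_entry (i : 'I_n) : measurable_fun [set: E] (fun v : E => v ord0 i).
Proof. exact: measurable_rV_coord. Qed.

Lemma measurable_rV_add : measurable_fun [set: E * E] (fun p : E * E => p.1 + p.2)%R.
Proof.
apply/measurable_fun_rVP => i; rewrite /comp /rV_coord.
under eq_fun do rewrite mxE.
apply: measurable_funD.
- exact: measurableT_comp (measurable_rV_entry i) measurable_fst.
- exact: measurableT_comp (measurable_rV_entry i) measurable_snd.
Qed.

Lemma measurable_rV_sub : measurable_fun [set: E * E] (fun p : E * E => p.1 - p.2)%R.
Proof.
apply/measurable_fun_rVP => i; rewrite /comp /rV_coord.
under eq_fun do rewrite !mxE.
apply: measurable_funB.
- exact: measurableT_comp (measurable_rV_entry i) measurable_fst.
- exact: measurableT_comp (measurable_rV_entry i) measurable_snd.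
Qed.

Lemma enorm_ge0 (x : E) : (0 <= enorm x)%R.
Proof. exact: sqrtr_ge0. Qed.

Lemma enorm_sqr (x : E) : (enorm x ^+ 2 = \sum_(i < n) x ord0 i ^+ 2)%R.
Proof. by rewrite sqr_sqrtr// sumr_ge0// => i _; exact: sqr_ge0. Qed.

Lemma measurable_enorm : measurable_fun [set: E] (@enorm R n).
Proof.
have msqrt : measurable_fun [set: R] (@Num.sqrt R).
  by apply: continuous_measurable_fun; exact: sqrt_continuous.
apply: (measurableT_comp msqrt).
apply: measurable_sum => i.
apply: measurable_funX; exact: measurable_rV_entry.
Qed.

Lemma quadratic_costE (x y : E) :
  (quadratic_cost x y = 2^-1 * \sum_(i < n) (x ord0 i - y ord0 i) ^+ 2)%R.
Proof.
by rewrite /quadratic_cost enorm_sqr; congr (_ * _)%R; apply: eq_bigr => i _; rewrite !mxE.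
Qed.

Lemma quadratic_cost_ge0 (x y : E) : (0 <= quadratic_cost x y)%R.
Proof. by rewrite /quadratic_cost mulr_ge0// ?invr_ge0// sqr_ge0. Qed.

Lemma measurable_quadratic_cost :
  measurable_fun [set: E * E] (fun p => quadratic_cost p.1 p.2).
Proof.
apply: measurable_funM => //; apply: measurable_funX.
exact: measurableT_comp measurable_enorm measurable_rV_sub.
Qed.

End rV_measurability.

Section lebesgue_rV_theory.
Context {R : realType}.

Lemma ge0_integral_lebesgue_rVS (n : nat) (f : 'rV[R]_n.+1 -> \bar R) :
  measurable_fun [set: 'rV[R]_n.+1] f -> (forall v, 0 <= f v) ->
  \int[lebesgue_rV R n.+1]_v f v =
  \int[lebesgue_measure]_t \int[lebesgue_rV R n]_v f (@rV_cons R n (t, v)).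
Proof.
move=> mf f0.
transitivity (\int[product_sfm (@lebesgue_measure R) (lebesgue_rV R n)]_p
   (f \o @rV_cons R n) p).
  rewrite -[in RHS](preimage_setT (@rV_cons R n)).
  by rewrite -(ge0_integral_pushforward (@measurable_rV_cons R n)).
rewrite -(@fubini_tonelli1 _ _ _ _ _ _ _ (f \o @rV_cons R n))//.
- exact: measurableT_comp mf (@measurable_rV_cons R n).
- by move=> p; exact: f0.
Qed.

Lemma integral_lebesgue_rV_prod (n : nat) (g : 'I_n -> R -> R) (a : 'I_n -> R) :
  (forall i, measurable_fun [set: R] (g i)) -> (forall i t, 0 <= g i t)%R ->
  (forall i, \int[lebesgue_measure]_t (g i t)%:E = (a i)%:E) ->
  \int[lebesgue_rV R n]_v (\prod_(i < n) g i (v ord0 i))%:E = (\prod_(i < n) a i)%:E.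
Proof.
elim: n g a => [|n IH] g a mg g0 ga.
  rewrite big_ord0 integral_dirac//= ?diracT ?mul1e ?big_ord0//.
  under eq_fun do rewrite big_ord0.
  exact: measurable_cst.
have mprod m (h : 'I_m -> R -> R) : (forall i, measurable_fun [set: R] (h i)) ->
    measurable_fun [set: 'rV[R]_m] (fun v : 'rV[R]_m => \prod_(i < m) h i (v ord0 i))%R.
  move=> mh; apply: measurable_prod => i _.
  by apply: measurableT_comp => //; exact: measurable_rV_entry.
rewrite ge0_integral_lebesgue_rVS; last 2 first.
- by apply/measurable_EFinP; exact: mprod.
- by move=> v; rewrite lee_fin prodr_ge0.
under eq_integral => t _.
  under eq_integral => v _.
    rewrite big_ord_recl rV_cons0/=.
    under eq_bigr do rewrite rV_consS/=.
    rewrite EFinM.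
    over.
  rewrite ge0_integralZl//; last 3 first.
  - by apply/measurable_EFinP; apply: (mprod n (fun i => g (lift ord0 i))).
  - by move=> v _; rewrite lee_fin prodr_ge0.
  - by rewrite lee_fin.
  rewrite (IH (fun i => g (lift ord0 i)) (fun i => a (lift ord0 i)))//.
  over.
rewrite ge0_integralZr//.
- by rewrite ga big_ord_recl EFinM.
- by apply/measurable_EFinP; exact: mg.
- by move=> t _; rewrite lee_fin.
- rewrite lee_fin prodr_ge0// => i _; rewrite -lee_fin -ga.
  by apply: integral_ge0 => t _; rewrite lee_fin.
Qed.

Lemma lebesgue_measure_shift (a : R) (A : set R) : measurable A ->
  pushforward lebesgue_measure (fun t : R => (t + a)%R : measurableTypeR R) A
  = lebesgue_measure A.
Proof.
have ma : measurable_fun [set: measurableTypeR R]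
    (fun t : measurableTypeR R => (t + a)%R : measurableTypeR R).
  by apply: measurable_funD.
move=> mA; apply/esym.
pose nu : {measure set (measurableTypeR R) -> \bar R} :=
  measure_function_pushforward__canonical__measure_function_Measure
    (@lebesgue_measure R) ma.
apply: (@lebesgue_measure_unique _ nu) => // _ [[b c]] _ <-.
rewrite /nu/= /pushforward/=.
rewrite (_ : _ @^-1` _ = `](b - a)%R, (c - a)%R]%classic); last first.
  by apply/seteqP; split => t /=; rewrite !in_itv/= ltrBlDr lerBrDr.
rewrite !lebesgue_measure_itv/= !lte_fin ltrD2r.
by case: ifPn => // _; rewrite -!EFinB; congr EFin; ring.
Qed.

Lemma ge0_integral_shift (a : R) (f : R -> \bar R) :
  measurable_fun [set: R] f -> (forall t, 0 <= f t) ->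
  \int[lebesgue_measure]_t f (t + a)%R = \int[lebesgue_measure]_t f t.
Proof.
move=> mf f0.
have ma : measurable_fun [set: measurableTypeR R]
    (fun t : measurableTypeR R => (t + a)%R : measurableTypeR R).
  by apply: measurable_funD.
rewrite -[in LHS](preimage_setT (fun t : measurableTypeR R => (t + a)%R : measurableTypeR R)).
rewrite -(ge0_integral_pushforward ma)//.
by apply: eq_measure_integral => A mA _; exact: lebesgue_measure_shift.
Qed.

(** Used to replace the variable [y] by [u = x + y] at fixed [x], so that integrals over pairs can
    be cut along antidiagonals. *)
Lemma ge0_integral_lebesgue_rV_shift (n : nat) (a : 'rV[R]_n) (f : 'rV[R]_n -> \bar R) :
  measurable_fun [set: 'rV[R]_n] f -> (forall v, 0 <= f v) ->
  \int[lebesgue_rV R n]_v f (v + a)%R = \int[lebesgue_rV R n]_v f v.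
Proof.
elim: n a f => [|n IH] a f mf f0.
  by apply: eq_integral => v _; congr f; apply/rowP => -[].
have mfa : measurable_fun [set: 'rV[R]_n.+1] (fun v => f (v + a)%R).
  apply: measurableT_comp => //.
  exact: (measurableT_comp (@measurable_rV_add R n.+1) (pair2_measurable a)).
rewrite !ge0_integral_lebesgue_rVS//.
pose a' : 'rV[R]_n := \row_j a ord0 (lift ord0 j).
have consa t v : (@rV_cons R n (t, v) + a)%R = rV_cons ((t + a ord0 ord0)%R, (v + a')%R).
  apply/rowP => i; rewrite mxE; case: (unliftP ord0 i) => [j ->|->].
    by rewrite !rV_consS !mxE.
  by rewrite !rV_cons0.
have mcons : measurable_fun [set: measurableTypeR R * 'rV[R]_n] (f \o @rV_cons R n).
  exact: measurableT_comp mf (@measurable_rV_cons R n).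
have IHt t : \int[lebesgue_rV R n]_v f (rV_cons (t, v) + a)%R =
    \int[lebesgue_rV R n]_v f (@rV_cons R n ((t + a ord0 ord0)%R, v)).
  under eq_integral do rewrite consa.
  rewrite (IH a' (fun v => f (rV_cons ((t + a ord0 ord0)%R, v))))//.
  exact: (measurable_fun_pair2 _ mcons).
under eq_integral do rewrite IHt.
pose F : R -> \bar R := fun t => \int[lebesgue_rV R n]_v f (@rV_cons R n (t, v)).
rewrite (@ge0_integral_shift (a ord0 ord0) F)//.
- have := @measurable_fun_fubini_tonelli_F _ _ _ _ _ (lebesgue_rV R n) _ mcons.
  by apply => p; exact: f0.
- by move=> t; exact: integral_ge0.
Qed.

Lemma ge0_integral_lebesgue_rV2 (n : nat) (f : 'rV[R]_n * 'rV[R]_n -> \bar R) :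
  measurable_fun [set: 'rV[R]_n * 'rV[R]_n] f -> (forall p, 0 <= f p) ->
  \int[lebesgue_rV2 R n]_p f p =
  \int[lebesgue_rV R n]_x \int[lebesgue_rV R n]_y f (x, y).
Proof.
exact: ge0_integral_product_sfm.
Qed.

End lebesgue_rV_theory.

(** * Entropy *)

Section entropy_comparison.
Context d (T : measurableType d) (R : realType).
Implicit Types nu : {sigma_finite_measure set T -> \bar R}.

(** An everywhere finite and nonnegative version of the density, so that logarithms and quotients
    are taken in [R]. *)
Definition is_density nu (mu : {measure set T -> \bar R}) (rho : T -> R) : Prop :=
  [/\ measurable_fun [set: T] rho, (forall x, 0 <= rho x)%R &
    forall f : T -> \bar R, measurable_fun [set: T] f -> (forall x, 0 <= f x) ->
      \int[mu]_x f x = \int[nu]_x (f x * (rho x)%:E)].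

Lemma ae_dominates nu (mu : {measure set T -> \bar R}) (P : T -> Prop) :
  mu `<< nu -> {ae nu, forall x, P x} -> {ae mu, forall x, P x}.
Proof.
move=> /null_content_dominatesP munu [A [mA A0 PA]]; exists A; split => //.
exact: munu.
Qed.

(** The second clause is what connects [rho] to [entropy], which is defined with the Radon-Nikodym
    derivative. *)
Lemma density_exists nu (mu : {finite_measure set T -> \bar R}) :
  mu `<< nu -> exists rho, is_density nu mu rho /\
    ae_eq nu setT (EFin \o rho) (Radon_Nikodym (charge_of_finite_measure mu) nu).
Proof.
move=> munu; pose f := Radon_Nikodym_SigmaFinite.f mu nu.
have f0 x : 0 <= f x by exact: Radon_Nikodym_SigmaFinite.f_ge0.
have ffin x : f x \is a fin_num by exact: Radon_Nikodym_SigmaFinite.f_fin_num.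
have mf : measurable_fun [set: T] f.
  exact: measurable_int (Radon_Nikodym_SigmaFinite.f_integrable munu).
have fE : EFin \o (fine \o f) = f by apply/funext => x /=; rewrite fineK.
exists (fine \o f); split; last first.
  by rewrite fE; exact: ae_eq_Radon_Nikodym_SigmaFinite.
split.
- by apply: measurableT_comp.
- by move=> x /=; apply: fine_ge0.
- move=> g mg g0; rewrite -(Radon_Nikodym_SigmaFinite.change_of_variables munu)//.
  by apply: eq_integral => x _; rewrite /= fineK.
Qed.

Lemma density_measureE nu (mu : {measure set T -> \bar R}) rho A :
  is_density nu mu rho -> measurable A -> mu A = \int[nu]_(x in A) (rho x)%:E.
Proof.
move=> [mr r0 ir] mA.
rewrite -[A in LHS]setIT -integral_indic// ir//.
- rewrite [RHS]integral_mkcond; apply: eq_integral => x _.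
  by rewrite epatch_indic muleC.
- by apply/measurable_EFinP; exact: measurable_indic.
Qed.

Lemma density_integrable nu (mu : {finite_measure set T -> \bar R}) rho :
  is_density nu mu rho -> nu.-integrable [set: T] (EFin \o rho).
Proof.
move=> rd; have [mr r0 ir] := rd; apply/integrableP; split.
  by apply/measurable_EFinP.
under eq_integral do rewrite gee0_abs ?lee_fin//.
by rewrite -(density_measureE rd)// -ge0_fin_numE// fin_num_measure.
Qed.

(** The mass that [mu] gives to the zero set of [rho] is the integral of 0. *)
Lemma density_gt0 nu (mu : {measure set T -> \bar R}) rho :
  is_density nu mu rho -> {ae mu, forall x, (0 < rho x)%R}.
Proof.
move=> rd; have [mr r0 ir] := rd.
have mA : measurable [set x | rho x = 0%R].
  by have := mr measurableT [set 0%R] (measurable_set1 _); rewrite setTI.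
exists [set x | rho x = 0%R]; split => //.
- rewrite (density_measureE rd)//; apply: integral0_eq => x /= ->.
  by [].
- by move=> x /= /negP; rewrite -leNgt => rx; apply/eqP; rewrite eq_le rx r0.
Qed.

(** Against [mu], the quotient [q / rho] integrates to the integral of [q] over the set where
    [rho > 0], which may be less than the full one. Where [rho] vanishes the quotient is 0 by
    convention. *)
Lemma ratio_integrable nu (mu : {measure set T -> \bar R}) rho (q : T -> R) (C : R) :
  is_density nu mu rho ->
  measurable_fun [set: T] q -> (forall x, 0 <= q x)%R ->
  \int[nu]_x (q x)%:E <= C%:E ->
  mu.-integrable [set: T] (fun x => (q x / rho x)%:E) /\
  \int[mu]_x (q x / rho x)%:E <= C%:E.
Proof.
move=> [mr r0 ir] mq q0 qC.
have mh : measurable_fun [set: T] (fun x => (q x / rho x)%:E).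
  apply/measurable_EFinP; apply: measurable_funM => //.
  under eq_fun do rewrite -powR_inv1//.
  exact: measurableT_comp (measurable_powR (-1)%R) mr.
have h0 x : 0 <= (q x / rho x)%:E by rewrite lee_fin divr_ge0.
have hC : \int[mu]_x (q x / rho x)%:E <= C%:E.
  apply: le_trans qC; rewrite ir//; apply: ge0_le_integral => //.
  - by move=> x _; rewrite mule_ge0 ?h0 ?lee_fin.
  - by apply: emeasurable_funM => //; apply/measurable_EFinP.
  - by apply/measurable_EFinP.
  - move=> x _; rewrite -EFinM lee_fin -mulrA.
    have [->|rx] := eqVneq (rho x) 0%R; first by rewrite mulr0 mulr0.
    by rewrite mulVf// mulr1.
split => //; apply/integrableP; split => //.
under eq_integral do rewrite gee0_abs//.
exact: le_lt_trans hC (ltry _).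
Qed.

(** This is [ln t <= t - 1] at [t = q / r]; if [r] is a probability density and [q] has mass at most
    1, the correction [q / r - 1] has nonpositive mean. *)
Lemma ln_le_ratio (q r : R) : (0 < q -> 0 < r -> ln q <= ln r + (q / r - 1))%R.
Proof.
move=> q0 r0; rewrite -lerBlDl -ln_div//.
have qr0 : (0 < q / r)%R by rewrite divr_gt0.
rewrite -[in ln _](subrKC 1%R (q / r)) le_ln1Dx//.
by rewrite ltrBrDl subrr.
Qed.

Lemma entropy_density nu (mu : probability T R) rho :
  mu `<< nu -> is_density nu mu rho ->
  ae_eq nu setT (EFin \o rho) (Radon_Nikodym (charge_of_finite_measure mu) nu) ->
  entropy nu mu = \int[mu]_x (ln (rho x))%:E.
Proof.
move=> munu [mr _ _] rE; rewrite /entropy; case: asboolP => // _.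
have mRN : measurable_fun [set: T] (Radon_Nikodym (charge_of_finite_measure mu) nu).
  by apply: measurable_int; exact: Radon_Nikodym_integrable.
apply: ae_eq_integral => //.
- apply/measurable_EFinP; apply: measurableT_comp; first exact: measurable_ln.
  by apply: measurableT_comp.
- by apply/measurable_EFinP; apply: measurableT_comp => //; exact: measurable_ln.
- apply: ae_dominates munu _; apply: filterS rE => x rE xT.
  by rewrite -rE.
Qed.

(* Gibbs' inequality: integrate [ln q - q / rho + 1 <= ln rho]. *)
Lemma entropy_ge_integral nu (mu : probability T R) (q : T -> R) :
  measurable_fun [set: T] q -> (forall x, 0 < q x)%R ->
  \int[nu]_x (q x)%:E <= 1 ->
  mu.-integrable [set: T] (fun x => (ln (q x))%:E) ->
  \int[mu]_x (ln (q x))%:E <= entropy nu mu.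
Proof.
move=> mq q0 q1 iq.
have [munu|nmunu] := pselect (mu `<< nu); last first.
  by rewrite /entropy; case: asboolP => // _; rewrite leey.
have [rho [rd rE]] := density_exists munu.
rewrite (entropy_density munu rd rE).
have [mr r0 ir] := rd.
have [ih hC] := ratio_integrable rd mq (fun x => ltW (q0 x)) q1.
have i1 : mu.-integrable [set: T] (EFin \o cst (-1)%R).
  exact: finite_measure_integrable_cst.
have ih1 := integrableD measurableT ih i1.
have mlnr : measurable_fun [set: T] (fun x => (ln (rho x))%:E).
  by apply/measurable_EFinP; apply: measurableT_comp => //; exact: measurable_ln.
apply: (@le_trans _ _ (\int[mu]_x ((ln (q x))%:E - ((q x / rho x)%:E + (-1)%:E)))).
  rewrite integralB// leeBrDr ?integrable_fin_num// -[leRHS]adde0 leeD2l//.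
  rewrite integralD//= integral_cst//= probability_setT mule1.
  by rewrite EFinN sube_le0.
apply: ae_le_integral => //.
  apply: emeasurable_funB; first exact: measurable_int iq.
  exact: measurable_int ih1.
apply: filterS (density_gt0 rd) => x rx.
by change (ln (q x) - (q x / rho x - 1) <= ln (rho x))%R;
  rewrite lerBlDr; exact: ln_le_ratio.
Qed.

End entropy_comparison.

(** * Lower bound on the entropy of a nearly optimal coupling *)

Section coupling_integrals.
Context {R : realType} {d : nat}.
Local Notation E := 'rV[R]_d.
Variables (mu0 mu1 : probability E R) (gamma : probability (E * E)%type R).
Hypothesis cg : couplings mu0 mu1 gamma.

Lemma coupling_fst_ge0 (f : E -> \bar R) :
  measurable_fun [set: E] f -> (forall x, 0 <= f x) ->
  \int[gamma]_p f p.1 = \int[mu0]_x f x.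
Proof.
move=> mf f0.
have mfst : measurable_fun [set: E * E] (fst : E * E -> E) by exact: measurable_fst.
rewrite -[in LHS](preimage_setT (fst : E * E -> E)).
rewrite -(ge0_integral_pushforward mfst)//.
by apply: eq_measure_integral => A mA _; have [h _] := cg mA; exact: h.
Qed.

Lemma coupling_snd_ge0 (f : E -> \bar R) :
  measurable_fun [set: E] f -> (forall x, 0 <= f x) ->
  \int[gamma]_p f p.2 = \int[mu1]_x f x.
Proof.
move=> mf f0.
have msnd : measurable_fun [set: E * E] (snd : E * E -> E) by exact: measurable_snd.
rewrite -[in LHS](preimage_setT (snd : E * E -> E)).
rewrite -(ge0_integral_pushforward msnd)//.
by apply: eq_measure_integral => A mA _; have [_ h] := cg mA; exact: h.
Qed.

Lemma coupling_fst_integrable (f : E -> \bar R) : mu0.-integrable [set: E] f ->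
  gamma.-integrable [set: E * E] (fun p => f p.1).
Proof.
move=> /integrableP[mf fi]; apply/integrableP; split.
  exact: measurableT_comp mf measurable_fst.
by rewrite (coupling_fst_ge0 (f := fun x => `|f x|))//; exact: measurableT_comp.
Qed.

Lemma coupling_snd_integrable (f : E -> \bar R) : mu1.-integrable [set: E] f ->
  gamma.-integrable [set: E * E] (fun p => f p.2).
Proof.
move=> /integrableP[mf fi]; apply/integrableP; split.
  exact: measurableT_comp mf measurable_snd.
by rewrite (coupling_snd_ge0 (f := fun x => `|f x|))//; exact: measurableT_comp.
Qed.

Lemma coupling_fst (f : E -> \bar R) : mu0.-integrable [set: E] f ->
  \int[gamma]_p f p.1 = \int[mu0]_x f x.
Proof.
move=> fi; have mf := measurable_int _ fi.
rewrite [RHS]integralE -!coupling_fst_ge0//; [|exact: measurable_funeneg|exact: measurable_funepos].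
rewrite [LHS]integralE; congr (_ - _); apply: eq_integral => p _.
  by rewrite !funeposE.
by rewrite !funenegE.
Qed.

Lemma coupling_snd (f : E -> \bar R) : mu1.-integrable [set: E] f ->
  \int[gamma]_p f p.2 = \int[mu1]_x f x.
Proof.
move=> fi; have mf := measurable_int _ fi.
rewrite [RHS]integralE -!coupling_snd_ge0//; [|exact: measurable_funeneg|exact: measurable_funepos].
rewrite [LHS]integralE; congr (_ - _); apply: eq_integral => p _.
  by rewrite !funeposE.
by rewrite !funenegE.
Qed.

Lemma coupling_ae_snd (P : E -> Prop) :
  {ae mu1, forall x, P x} -> {ae gamma, forall p, P p.2}.
Proof.
move=> [A [mA A0 PA]]; exists (snd @^-1` A); split.
- by rewrite -[X in measurable X]setTI; exact: measurable_snd.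
- by have [_] := cg mA; rewrite /pushforward => ->.
- by move=> p /= nP; exact: PA.
Qed.

Lemma quadratic_cost_le (x y : E) : (quadratic_cost x y <= enorm x ^+ 2 + enorm y ^+ 2)%R.
Proof.
rewrite quadratic_costE !enorm_sqr -big_split/= mulr_sumr; apply: ler_sum => i _.
rewrite -subr_ge0 (_ : _ - _ = 2^-1 * (x ord0 i + y ord0 i) ^+ 2)%R; last by field.
by rewrite mulr_ge0// ?sqr_ge0// invr_ge0.
Qed.

Lemma sqr_enormD_le (x y : E) :
  (enorm (x + y) ^+ 2 <= 2 * (enorm x ^+ 2 + enorm y ^+ 2))%R.
Proof.
rewrite !enorm_sqr -big_split/= mulr_sumr; apply: ler_sum => i _; rewrite mxE.
rewrite -subr_ge0 (_ : _ - _ = (x ord0 i - y ord0 i) ^+ 2)%R; last by ring.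
exact: sqr_ge0.
Qed.

Variables (K0 K1 : R).
Hypotheses (hK0 : \int[mu0]_x (enorm x ^+ 2)%:E <= K0%:E)
  (hK1 : \int[mu1]_x (enorm x ^+ 2)%:E <= K1%:E).

Lemma measurable_sqr_enorm : measurable_fun [set: E] (fun x : E => (enorm x ^+ 2)%:E).
Proof. by apply/measurable_EFinP; apply: measurable_funX; exact: measurable_enorm. Qed.

Lemma coupling_second_moment :
  \int[gamma]_p (enorm p.1 ^+ 2 + enorm p.2 ^+ 2)%:E <= (K0 + K1)%:E.
Proof.
under eq_integral do rewrite EFinD.
have m2 := measurable_sqr_enorm.
rewrite ge0_integralD//; last 4 first.
- by move=> p _; rewrite lee_fin sqr_ge0.
- exact: measurableT_comp m2 measurable_fst.
- by move=> p _; rewrite lee_fin sqr_ge0.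
- exact: measurableT_comp m2 measurable_snd.
rewrite (coupling_fst_ge0 m2); last by move=> x; rewrite lee_fin sqr_ge0.
rewrite (coupling_snd_ge0 m2); last by move=> x; rewrite lee_fin sqr_ge0.
by rewrite EFinD leeD.
Qed.

Lemma integrable_second_moment :
  gamma.-integrable [set: E * E] (fun p : E * E => (enorm p.1 ^+ 2 + enorm p.2 ^+ 2)%:E).
Proof.
apply/integrableP; split.
  apply/measurable_EFinP; apply: measurable_funD; apply: measurable_funX.
  - exact: measurableT_comp (@measurable_enorm R d) measurable_fst.
  - exact: measurableT_comp (@measurable_enorm R d) measurable_snd.
under eq_integral do rewrite gee0_abs ?lee_fin ?addr_ge0 ?sqr_ge0//.
exact: le_lt_trans coupling_second_moment (ltry _).
Qed.

Lemma integrable_quadratic_cost :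
  gamma.-integrable [set: E * E] (fun p => (quadratic_cost p.1 p.2)%:E).
Proof.
apply: le_integrable integrable_second_moment => //.
  by apply/measurable_EFinP; exact: measurable_quadratic_cost.
move=> p _; rewrite !gee0_abs ?lee_fin ?quadratic_cost_ge0 ?addr_ge0 ?sqr_ge0//.
exact: quadratic_cost_le.
Qed.

End coupling_integrals.

(** * Gaussian densities on row vectors *)

Section gaussian.
Context {R : realType} {d : nat}.
Local Notation E := 'rV[R]_d.

(** Written as a product so that the normalisation reduces to dimension one; [s] is the common
    standard deviation. *)
Definition gaussian_pdf (c : E) (s : R) (x : E) : R :=
  (\prod_(i < d) normal_pdf (c ord0 i) s (x ord0 i))%R.

Lemma gaussian_pdfE (c : E) (s : R) (x : E) : s != 0%R ->
  gaussian_pdf c s x =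
  (normal_peak s ^+ d * expR (- (enorm (x - c) ^+ 2 / (s ^+ 2 *+ 2))))%R.
Proof.
move=> s0; rewrite /gaussian_pdf.
under eq_bigr do rewrite normal_pdfE//.
rewrite big_split/= prodr_const card_ord; congr (_ * _)%R.
rewrite -expR_sum; congr expR; rewrite enorm_sqr mulr_suml -sumrN.
by apply: eq_bigr => i _; rewrite !mxE mulNr.
Qed.

Lemma gaussian_pdf_ge0 c s x : (0 <= gaussian_pdf c s x)%R.
Proof. by apply: prodr_ge0 => i _; exact: normal_pdf_ge0. Qed.

Lemma measurable_gaussian_pdf c s : measurable_fun [set: E] (gaussian_pdf c s).
Proof.
apply: measurable_prod => i _.
exact: measurableT_comp (measurable_normal_pdf _ _) (measurable_rV_entry i).
Qed.

Lemma integral_gaussian_pdf c s : \int[lebesgue_rV R d]_x (gaussian_pdf c s x)%:E = 1.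
Proof.
rewrite (@integral_lebesgue_rV_prod R d (fun i => normal_pdf (c ord0 i) s) (fun=> 1%R)).
- by rewrite big1.
- by move=> i; exact: measurable_normal_pdf.
- by move=> i t; exact: normal_pdf_ge0.
- by move=> i; exact: integral_normal_pdf.
Qed.

Lemma ln_normal_peak (s : R) : (0 < s)%R ->
  (ln (normal_peak s) = - (ln s + 2^-1 * ln (pi *+ 2)))%R.
Proof.
move=> s0; have p0 : (0 < pi *+ 2 :> R)%R by rewrite mulrn_wgt0// pi_gt0.
have sp : (0 < s ^+ 2 * pi *+ 2)%R by rewrite mulrn_wgt0// mulr_gt0 ?pi_gt0// exprn_gt0.
rewrite /normal_peak lnV ?posrE ?sqrtr_gt0//; congr (- _)%R.
rewrite -powR12_sqrt ?ltW// ln_powR -mulrnAr lnM ?posrE ?exprn_gt0// lnXn//.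
by rewrite mulrDr -mulr_natl; field.
Qed.

End gaussian.

(** * Gibbs' inequality against the density built from the gap *)

Section entropy_lower_bound.
Context {R : realType} {d : nat}.
Local Notation E := 'rV[R]_d.
Variables (phi psi : E -> R).
Hypotheses (mphi : measurable_fun [set: E] phi) (mpsi : measurable_fun [set: E] psi).
Hypothesis adm : forall x y, (phi x + psi y <= quadratic_cost x y)%R.
Let gap := duality_gap (@quadratic_cost R d) phi psi.

Lemma duality_gap_ge0 x y : (0 <= gap x y)%R.
Proof. by rewrite /gap /duality_gap -addrA -opprD subr_ge0. Qed.

Lemma measurable_duality_gap : measurable_fun [set: E * E] (fun p => gap p.1 p.2).
Proof.
apply: measurable_funB; first apply: measurable_funB.
- exact: measurable_quadratic_cost.
- exact: measurableT_comp mphi measurable_fst.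
- exact: measurableT_comp mpsi measurable_snd.
Qed.

(* Minty's trick: on an antidiagonal [x + y = u] the gap is quadratically
   coercive, because exchanging the partners of two points of it costs exactly
   the squared distance of their first components. *)
Lemma duality_gap_antidiagonal (u x x' : E) :
  (enorm (x - x') ^+ 2 <= gap x (u - x) + gap x' (u - x'))%R.
Proof.
have h1 := adm x (u - x'); have h2 := adm x' (u - x).
have -> : (enorm (x - x') ^+ 2 =
    quadratic_cost x (u - x) + quadratic_cost x' (u - x')
    - quadratic_cost x (u - x') - quadratic_cost x' (u - x))%R.
  rewrite enorm_sqr !quadratic_costE -!mulrDr -!mulrBr -!big_split/= -!sumrB mulr_sumr.
  by apply: eq_bigr => i _; rewrite !mxE; field.
by rewrite /gap /duality_gap; lra.
Qed.

(** The point [c] minimises the gap on the antidiagonal up to [tau]; the infimum need not be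
    attained, the potentials being only measurable. Since the gap at [c] is then at most the gap at
    [x] plus [tau], Minty's inequality gives [|x - c|^2 <= 2 gap + tau]. *)
Lemma duality_gap_quadratic_growth (tau : R) (u : E) : (0 < tau)%R ->
  exists c : E, forall x, (enorm (x - c) ^+ 2 / 2 - tau / 2 <= gap x (u - x))%R.
Proof.
move=> tau0.
pose S := [set gap x (u - x) | x in [set: E]].
have S0 : has_inf S.
  split; first by exists (gap 0%R (u - 0)), 0%R.
  by exists 0%R => _ [x _ <-]; exact: duality_gap_ge0.
have [_ [c _ <-] cS] := inf_adherent tau0 S0.
exists c => x.
have xS : (inf S <= gap x (u - x))%R.
  by apply: ge_inf; [exact: S0.2|exists x].
have := duality_gap_antidiagonal u x c; lra.
Qed.

(** The factor [expR (- 2^-1)] absorbs the slack [tau / 2] of the quadratic growth divided by [tau],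
    and the peak normalises a Gaussian of variance [tau] along each antidiagonal. *)
Let gibbs (tau : R) (p : E * E) : R :=
  (expR (- 2^-1) * normal_peak (Num.sqrt tau) ^+ d * expR (- (gap p.1 p.2 / tau))
   * gaussian_pdf 0 1 (p.1 + p.2))%R.

Let gibbs_ge0 tau p : (0 <= gibbs tau p)%R.
Proof.
by rewrite /gibbs !mulr_ge0 ?expR_ge0 ?exprn_ge0 ?normal_peak_ge0 ?gaussian_pdf_ge0.
Qed.

Let measurable_gibbs tau : measurable_fun [set: E * E] (gibbs tau).
Proof.
apply: measurable_funM; first apply: measurable_funM => //.
- apply: measurableT_comp; first exact: measurable_expR.
  by apply: measurableT_comp => //; apply: measurable_funM => //; exact: measurable_duality_gap.
- exact: measurableT_comp (measurable_gaussian_pdf _ _) (@measurable_rV_add R d).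
Qed.

(** By quadratic growth the integrand lies below the weight of [u] times a Gaussian of variance
    [tau] centred at [c]. The centre depends on [u], but the mass does not. *)
Let integral_gibbs_slice (tau : R) (u : E) : (0 < tau)%R ->
  \int[lebesgue_rV R d]_x (gibbs tau (x, (u - x)%R))%:E <= (gaussian_pdf 0 1 u)%:E.
Proof.
move=> tau0; have [c hc] := duality_gap_quadratic_growth u tau0.
have st0 : (Num.sqrt tau != 0 :> R)%R by rewrite gt_eqF// sqrtr_gt0.
have mg : measurable_fun [set: E] (fun x : E => (gaussian_pdf c (Num.sqrt tau) x)%:E).
  by apply/measurable_EFinP; exact: measurable_gaussian_pdf.
apply: (@le_trans _ _ (\int[lebesgue_rV R d]_x
    ((gaussian_pdf 0 1 u)%:E * (gaussian_pdf c (Num.sqrt tau) x)%:E))).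
  apply: ge0_le_integral => //.
  - by move=> x _; rewrite lee_fin.
  - apply/measurable_EFinP.
    apply: (measurableT_comp (measurable_gibbs tau)).
    apply: measurable_fun_pair => //.
    exact: (measurableT_comp (@measurable_rV_sub R d) (pair1_measurable u)).
  - by apply: emeasurable_funM.
  - move=> x _; rewrite -EFinM lee_fin /gibbs/= subrKC mulrC ler_wpM2l ?gaussian_pdf_ge0//.
    rewrite gaussian_pdfE// (sqr_sqrtr (ltW tau0)) -mulrA mulrCA.
    rewrite ler_wpM2l ?exprn_ge0 ?normal_peak_ge0// -expRD ler_expR.
    rewrite -(ler_pM2r tau0) mulrDl !mulNr divfK ?gt_eqF//.
    rewrite (_ : _ / _ * tau = enorm (x - c) ^+ 2 / 2)%R; last first.
      by rewrite -mulr_natl; field; rewrite gt_eqF.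
    have := hc x; lra.
rewrite ge0_integralZl ?integral_gaussian_pdf ?mule1//.
- by move=> x _; rewrite lee_fin gaussian_pdf_ge0.
- by rewrite lee_fin gaussian_pdf_ge0.
Qed.

Let integral_gibbs (tau : R) : (0 < tau)%R ->
  \int[lebesgue_rV2 R d]_p (gibbs tau p)%:E <= 1.
Proof.
move=> tau0.
have mG : measurable_fun [set: E * E] (fun p => (gibbs tau p)%:E).
  by apply/measurable_EFinP.
pose G' (p : E * E) := (gibbs tau (p.1, (p.2 - p.1)%R))%:E.
have mG' : measurable_fun [set: E * E] G'.
  apply: (measurableT_comp mG); apply: measurable_fun_pair => //.
  exact: (measurableT_comp (@measurable_rV_sub R d)
    (measurable_fun_pair measurable_snd measurable_fst)).
have -> : \int[lebesgue_rV2 R d]_p (gibbs tau p)%:E =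
    \int[lebesgue_rV R d]_x \int[lebesgue_rV R d]_y (gibbs tau (x, y))%:E.
  by rewrite (ge0_integral_lebesgue_rV2 mG)// => p; rewrite lee_fin.
(* At fixed [x] the inner variable becomes [u = x + y]; Tonelli then puts the integral over the
   antidiagonals outside. *)
under eq_integral => x _.
  rewrite -(ge0_integral_lebesgue_rV_shift (- x) (measurable_fun_pair2 x mG)); last first.
    by move=> v; rewrite lee_fin.
  over.
rewrite (@fubini_tonelli _ _ _ _ _ (lebesgue_rV R d) (lebesgue_rV R d) G' mG'); last first.
  by move=> p; rewrite lee_fin.
rewrite -(integral_gaussian_pdf (0 : E) 1); apply: ge0_le_integral => //.
- by move=> u _; apply: integral_ge0 => x _; rewrite lee_fin.
- by apply: measurable_fun_fubini_tonelli_G => // p; rewrite lee_fin.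
- by apply/measurable_EFinP; exact: measurable_gaussian_pdf.
- by move=> u _; exact: integral_gibbs_slice.
Qed.

(* Collects the normalisations of the reference density
   [exp (- gap / tau) w(x + y)] with [w] the standard Gaussian density. *)
Definition entropy_lower_const (K : R) : R :=
  (5 / 2 + K + d%:R * ln (pi *+ 2))%R.

(** The factor 2 leaves room for a suboptimality and a duality defect of at most [tau] each. In the
    mean of [ln gibbs], the gap then costs at most 2, the weight of [x + y] at most [K0 + K1], and
    each of the two peaks [d / 2 * ln (2 pi)]. *)
Lemma entropy_lower_bound (mu0 mu1 : probability E R)
    (gamma : probability (E * E)%type R) (K0 K1 tau : R) :
  couplings mu0 mu1 gamma ->
  \int[mu0]_x (enorm x ^+ 2)%:E <= K0%:E -> \int[mu1]_x (enorm x ^+ 2)%:E <= K1%:E ->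
  (0 < tau)%R ->
  gamma.-integrable [set: E * E] (fun p => (gap p.1 p.2)%:E) ->
  \int[gamma]_p (gap p.1 p.2)%:E <= (2 * tau)%:E ->
  (- (d%:R / 2 * ln tau) - entropy_lower_const (K0 + K1))%:E
    <= entropy (lebesgue_rV2 R d) gamma.
Proof.
move=> cg hK0 hK1 tau0 igap gap_le.
have st0 : (0 < Num.sqrt tau :> R)%R by rewrite sqrtr_gt0.
have gibbs_gt0 p : (0 < gibbs tau p)%R.
  rewrite /gibbs gaussian_pdfE ?oner_neq0//.
  by rewrite !mulr_gt0 ?expR_gt0 ?exprn_gt0 ?normal_peak_gt0// ?oner_neq0 ?gt_eqF.
pose A : R := (- 2^-1 - d%:R / 2 * ln tau - d%:R * ln (pi *+ 2))%R.
have lnE p : ln (gibbs tau p) =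
    (A - gap p.1 p.2 / tau - enorm (p.1 + p.2)%R ^+ 2 / 2)%R.
  rewrite /gibbs gaussian_pdfE ?oner_neq0//.
  rewrite !lnM ?posrE ?mulr_gt0 ?expR_gt0 ?exprn_gt0 ?normal_peak_gt0// ?oner_neq0 ?gt_eqF//.
  rewrite !lnXn ?normal_peak_gt0// ?oner_neq0 ?gt_eqF// !expRK.
  rewrite !ln_normal_peak// ln1 -(powR12_sqrt (ltW tau0)) ln_powR subr0 expr1n.
  rewrite /A; move: (ln (pi *+ 2)) (ln tau) (enorm _) => P L e.
  have nE (x y : R) : (- (x + y) *+ d = - (d%:R * (x + y)))%R.
    by rewrite mulNrn mulr_natl.
  by rewrite !nE; field; rewrite gt_eqF.
have iM := integrable_second_moment cg hK0 hK1.
have iu : gamma.-integrable [set: E * E] (fun p : E * E => (enorm (p.1 + p.2)%R ^+ 2 / 2)%:E).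
  apply: le_integrable iM => //.
    apply/measurable_EFinP; apply: measurable_funM => //; apply: measurable_funX.
    exact: measurableT_comp (@measurable_enorm R d) (@measurable_rV_add R d).
  move=> p _; rewrite !gee0_abs ?lee_fin ?divr_ge0 ?addr_ge0 ?sqr_ge0//.
  by have := sqr_enormD_le p.1 p.2; lra.
have ig := integrableZl measurableT (tau^-1)%R igap.
have ic : gamma.-integrable [set: E * E] (EFin \o cst A).
  exact: finite_measure_integrable_cst.
have ilnE : (fun p => (ln (gibbs tau p))%:E) =
    (fun p => (A%:E - (tau^-1)%:E * (gap p.1 p.2)%:E) - (enorm (p.1 + p.2)%R ^+ 2 / 2)%:E).
  by apply/funext => p; rewrite lnE [(_ / tau)%R]mulrC.
have iln : gamma.-integrable [set: E * E] (fun p => (ln (gibbs tau p))%:E).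
  by rewrite ilnE; apply: integrableB => //; apply: integrableB.
apply: le_trans (entropy_ge_integral _ gibbs_gt0 (integral_gibbs tau0) iln) => //.
rewrite ilnE integralB//; last exact: integrableB.
rewrite integralB// integralZl// integral_cst//= probability_setT mule1.
have le_u : \int[gamma]_p (enorm (p.1 + p.2)%R ^+ 2 / 2)%:E <= (K0 + K1)%:E.
  apply: le_trans (coupling_second_moment cg hK0 hK1).
  apply: ae_le_integral; [exact: measurable_int iu|exact: measurable_int iM|].
  by apply: aeW => p; rewrite lee_fin; have := sqr_enormD_le p.1 p.2; lra.
have le_g : (tau^-1)%:E * \int[gamma]_p (gap p.1 p.2)%:E <= 2%:E.
  rewrite (_ : 2%:E = (tau^-1)%:E * (2 * tau)%:E); last first.
    by rewrite -EFinM mulrCA mulVf ?mulr1// gt_eqF.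
  by rewrite lee_pmul2l// ?lte_fin ?invr_gt0// fin_numE.
apply: (@le_trans _ _ (A%:E - 2%:E - (K0 + K1)%:E)).
  by rewrite -!EFinB lee_fin /A /entropy_lower_const; lra.
by rewrite leeB// leeB.
Qed.

End entropy_lower_bound.

(** * Competitors with small entropy *)

Section resampling.
Context {R : realType} {d : nat}.
Local Notation E := 'rV[R]_d.
Local Notation T := (E * E)%type.
Variables (mu0 mu1 : probability E R) (gamma : probability T R).
Hypothesis cg : couplings mu0 mu1 gamma.

(* The law of [(p.1, q.2)] for [(p, q)] of density [G] with respect to
   [gamma \x gamma], completed by the part of density [g] of [gamma]. *)
Lemma resampling (g : T -> R) (G : T * T -> R) :
  measurable_fun [set: T] g -> measurable_fun [set: T * T] G ->
  (forall p, 0 <= g p)%R -> (forall z, 0 <= G z)%R ->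
  (forall p, (g p)%:E + \int[gamma]_q (G (p, q))%:E = 1) ->
  (forall q, (g q)%:E + \int[gamma]_p (G (p, q))%:E = 1) ->
  exists gamma' : probability T R, couplings mu0 mu1 gamma' /\
    forall f : T -> \bar R, measurable_fun [set: T] f -> (forall p, 0 <= f p) ->
      \int[gamma']_p f p = \int[gamma]_p (f p * (g p)%:E) +
        \int[gamma]_p \int[gamma]_q (f (p.1, q.2) * (G (p, q))%:E).
Proof.
move=> mg mG g0 G0 hfst hsnd.
have mgE : measurable_fun [set: T] (EFin \o g) by apply/measurable_EFinP.
have mGE : measurable_fun [set: T * T] (EFin \o G) by apply/measurable_EFinP.
have G0E z : 0 <= (EFin \o G) z by rewrite lee_fin.
have mGF : measurable_fun [set: T] (fun p => \int[gamma]_q (G (p, q))%:E).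
  exact: (@measurable_fun_fubini_tonelli_F _ _ _ _ _ gamma _ mGE).
have mGG : measurable_fun [set: T] (fun q => \int[gamma]_p (G (p, q))%:E).
  exact: (@measurable_fun_fubini_tonelli_G _ _ _ _ _ gamma _ mGE).
have iG0 p : 0 <= \int[gamma]_q (G (p, q))%:E.
  by apply: integral_ge0 => q _; rewrite lee_fin.
have scaleF c p : 0 <= c ->
    \int[gamma]_q (c * (G (p, q))%:E) = c * \int[gamma]_q (G (p, q))%:E.
  move=> c0; rewrite ge0_integralZl//; first exact: (measurable_fun_pair2 p mGE).
  by move=> q _; rewrite lee_fin.
have scaleG c q : 0 <= c ->
    \int[gamma]_p (c * (G (p, q))%:E) = c * \int[gamma]_p (G (p, q))%:E.
  move=> c0; rewrite ge0_integralZl//; first exact: (measurable_fun_pair1 q mGE).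
  by move=> p _; rewrite lee_fin.
have iG1 q : 0 <= \int[gamma]_p (G (p, q))%:E.
  by apply: integral_ge0 => p _; rewrite lee_fin.
have sum1 : \int[gamma]_p (g p)%:E + \int[gamma]_p \int[gamma]_q (G (p, q))%:E = 1.
  rewrite -ge0_integralD//; last by move=> p _; rewrite lee_fin.
  under eq_integral do rewrite hfst.
  by rewrite integral_cst//= probability_setT mule1.
have ig : gamma.-integrable [set: T] (EFin \o g).
  apply/integrableP; split => //.
  under eq_integral do rewrite gee0_abs ?lee_fin//.
  apply: (@le_lt_trans _ _ 1); last exact: ltry.
  by rewrite -sum1 leeDl// integral_ge0.
pose gg := product_sfm gamma gamma.
have ggE := @ge0_integral_product_sfm _ _ _ _ _ gamma gamma.
have iG : gg.-integrable [set: T * T] (EFin \o G).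
  apply/integrableP; split => //.
  under eq_integral do rewrite gee0_abs ?lee_fin//.
  rewrite ggE//.
  apply: (@le_lt_trans _ _ 1); last exact: ltry.
  by rewrite -sum1 leeDr// integral_ge0// => p _; rewrite lee_fin.
(* [nu1] is the part of [gamma] left in place; [nu2] lives on pairs of points, and [h] keeps the
   first component of one and the second component of the other. *)
have [nu1 [_ nu1E]] := density_measure (fun p => g0 p : 0 <= (EFin \o g) p) ig.
have [nu2 [_ nu2E]] := density_measure G0E iG.
pose h (z : T * T) : T := (z.1.1, z.2.2).
have mh : measurable_fun [set: T * T] h.
  apply: measurable_fun_pair.
    exact: measurableT_comp measurable_fst measurable_fst.
  exact: measurableT_comp measurable_snd measurable_snd.
pose nu3 : {measure set T -> \bar R} :=
  measure_function_pushforward__canonical__measure_function_Measure nu2 mh.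
pose nu : {measure set T -> \bar R} := measure_add nu1 nu3.
have nuE (f : T -> \bar R) : measurable_fun [set: T] f -> (forall p, 0 <= f p) ->
      \int[nu]_p f p = \int[gamma]_p (f p * (g p)%:E) +
        \int[gamma]_p \int[gamma]_q (f (p.1, q.2) * (G (p, q))%:E).
  move=> mf f0; rewrite ge0_integral_measure_add// nu1E//; congr (_ + _).
  rewrite -(preimage_setT h) in nu2E *.
  rewrite /nu3 (ge0_integral_pushforward mh)// preimage_setT.
  rewrite (nu2E (f \o h)); [|exact: (measurableT_comp mf mh)|by move=> z; exact: f0].
  rewrite (ggE (fun z => (f \o h) z * (EFin \o G) z))//.
    by apply: emeasurable_funM => //; exact: (measurableT_comp mf mh).
  by move=> z; rewrite mule_ge0//; exact: f0.
(* A function of [p.1] alone leaves the inner integral, and [hfst] recombines the two terms. The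
   second marginal is alike, after exchanging the order of integration. *)
have nu_fst (f : E -> \bar R) : measurable_fun [set: E] f -> (forall x, 0 <= f x) ->
    \int[nu]_p f p.1 = \int[mu0]_x f x.
  move=> mf f0; have mf1 : measurable_fun [set: T] (fun p => f p.1).
    exact: measurableT_comp mf measurable_fst.
  rewrite (nuE (fun p => f p.1))//=.
  under [X in _ + X]eq_integral do rewrite scaleF//.
  rewrite -ge0_integralD//; last 4 first.
  - by move=> p _; rewrite mule_ge0// lee_fin.
  - exact: emeasurable_funM.
  - by move=> p _; rewrite mule_ge0.
  - exact: emeasurable_funM.
  rewrite -(coupling_fst_ge0 cg)//; apply: eq_integral => p _.
  by rewrite -ge0_muleDr ?lee_fin// hfst mule1.
have nu_snd (f : E -> \bar R) : measurable_fun [set: E] f -> (forall x, 0 <= f x) ->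
    \int[nu]_p f p.2 = \int[mu1]_x f x.
  move=> mf f0; have mf2 : measurable_fun [set: T] (fun p => f p.2).
    exact: measurableT_comp mf measurable_snd.
  rewrite (nuE (fun p => f p.2))//=.
  have mF : measurable_fun [set: T * T] (fun z : T * T => f z.2.2 * (G z)%:E).
    by apply: emeasurable_funM => //; exact: measurableT_comp mf2 measurable_snd.
  rewrite (@fubini_tonelli _ _ _ _ _ gamma gamma (fun z : T * T => f z.2.2 * (G z)%:E))//; last first.
    by move=> z; rewrite mule_ge0 ?lee_fin.
  under [X in _ + X]eq_integral do rewrite /= scaleG//.
  rewrite -ge0_integralD//; last 4 first.
  - by move=> p _; rewrite mule_ge0// lee_fin.
  - exact: emeasurable_funM.
  - by move=> p _; rewrite mule_ge0// integral_ge0// => q _; rewrite lee_fin.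
  - exact: emeasurable_funM.
  rewrite -(coupling_snd_ge0 cg)//; apply: eq_integral => p _.
  by rewrite -ge0_muleDr ?lee_fin ?integral_ge0// ?hsnd ?mule1// => q _; rewrite lee_fin.
have nu1T : nu setT = 1.
  have := nu_fst (cst 1) (measurable_cst _) (fun=> lee01).
  by rewrite !integral_cst//= !mul1e probability_setT.
have [gamma' gE] := probability_of_measure nu1T.
exists gamma'; split; last first.
  by move=> f mf f0; rewrite -nuE//; apply: eq_measure_integral => A _ _; exact: gE.
move=> A mA.
have mi : measurable_fun [set: E] (fun x => (\1_A x : R)%:E).
  by apply/measurable_EFinP; exact: measurable_indic.
have i0 x : 0 <= (\1_A x : R)%:E by rewrite lee_fin.
have mA1 : measurable (fst @^-1` A : set T).
  by rewrite -[X in measurable X]setTI; exact: measurable_fst.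
have mA2 : measurable (snd @^-1` A : set T).
  by rewrite -[X in measurable X]setTI; exact: measurable_snd.
split.
  rewrite -[A in RHS]setIT -[in RHS](integral_indic mu0 measurableT mA).
  rewrite -(nu_fst _ mi i0) (integral_indic nu measurableT mA1) setIT.
  exact: gE.
rewrite -[A in RHS]setIT -[in RHS](integral_indic mu1 measurableT mA).
rewrite -(nu_snd _ mi i0) (integral_indic nu measurableT mA2) setIT.
exact: gE.
Qed.

End resampling.

Section entropy_upper_bound.
Context {R : realType} {d : nat}.
Local Notation E := 'rV[R]_d.
Local Notation T := (E * E)%type.

Lemma entropy_fin_integrable (mu : probability E R) rho (H : R) :
  mu `<< lebesgue_rV R d -> is_density (lebesgue_rV R d) mu rho ->
  ae_eq (lebesgue_rV R d) setT (EFin \o rho)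
    (Radon_Nikodym (charge_of_finite_measure mu) (lebesgue_rV R d)) ->
  entropy (lebesgue_rV R d) mu = H%:E ->
  mu.-integrable [set: E] (fun x => (ln (rho x))%:E) /\
  \int[mu]_x (ln (rho x))%:E = H%:E.
Proof.
move=> mul rd rE; rewrite (entropy_density mul rd rE) => h; split => //.
apply: integrable_of_integral_fin h.
have [mr _ _] := rd.
by apply/measurable_EFinP; apply: measurableT_comp => //; exact: measurable_ln.
Qed.

(* If [sigma] is the density of [nu], the density of [gamma] is at most
   [rho0(x) sigma(y)], and Gibbs' inequality for the subprobability density
   [sigma / N] bounds the integral of [ln sigma] by [H1 + ln N]. *)
Lemma entropy_upper_bound (mu0 mu1 : probability E R) (gamma : probability T R)
    (nu : {finite_measure set E -> \bar R}) (H0 H1 N : R) :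
  couplings mu0 mu1 gamma ->
  mu0 `<< lebesgue_rV R d -> mu1 `<< lebesgue_rV R d -> nu `<< lebesgue_rV R d ->
  entropy (lebesgue_rV R d) mu0 = H0%:E -> entropy (lebesgue_rV R d) mu1 = H1%:E ->
  (0 < N)%R -> nu setT <= N%:E ->
  (forall f : T -> \bar R, measurable_fun [set: T] f -> (forall p, 0 <= f p) ->
    \int[gamma]_p f p <= \int[mu0]_x \int[nu]_y f (x, y)) ->
  entropy (lebesgue_rV2 R d) gamma <= (H0 + H1 + ln N)%:E.
Proof.
move=> cg mu0l mu1l nul eH0 eH1 N0 nuN dom.
have [r0 [rd0 rE0]] := density_exists mu0l.
have [r1 [rd1 rE1]] := density_exists mu1l.
have [s [sd _]] := density_exists nul.
have [il0 eq0] := entropy_fin_integrable mu0l rd0 rE0 eH0.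
have [il1 eq1] := entropy_fin_integrable mu1l rd1 rE1 eH1.
have [mr0 r00 ir0] := rd0; have [mr1 r10 ir1] := rd1; have [ms s0 iS] := sd.
pose q (p : T) := (r0 p.1 * s p.2)%R.
have q0 p : (0 <= q p)%R by rewrite mulr_ge0.
have mq : measurable_fun [set: T] q.
  apply: measurable_funM.
    exact: measurableT_comp mr0 measurable_fst.
  exact: measurableT_comp ms measurable_snd.
have mqE : measurable_fun [set: T] (EFin \o q) by apply/measurable_EFinP.
have domq (f : T -> \bar R) : measurable_fun [set: T] f -> (forall p, 0 <= f p) ->
    \int[mu0]_x \int[nu]_y f (x, y) = \int[lebesgue_rV2 R d]_p (f p * (q p)%:E).
  move=> mf f0; rewrite ir0; last 2 first.
  - exact: (@measurable_fun_fubini_tonelli_F _ _ _ _ _ nu _ mf).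
  - by move=> x; exact: integral_ge0.
  rewrite ge0_integral_lebesgue_rV2; last 2 first.
  - exact: emeasurable_funM.
  - by move=> p; rewrite mule_ge0// lee_fin.
  apply: eq_integral => x _.
  have mfx := measurable_fun_pair2 x mf.
  rewrite (iS (fun y => f (x, y)))// -ge0_integralZr//.
  - by apply: eq_integral => y _; rewrite /q/= -muleA -EFinM [(r0 x * _)%R]mulrC.
  - by apply: emeasurable_funM => //; apply/measurable_EFinP.
  - by move=> y _; rewrite mule_ge0// lee_fin.
  - by rewrite lee_fin.
(* The domination, tested on indicators, gives both the absolute continuity of [gamma] and the bound
   of its density by [q]. *)
have domB B : measurable B -> gamma B <= \int[lebesgue_rV2 R d]_(p in B) (q p)%:E.
  move=> mB; rewrite -[B in leLHS]setIT -(integral_indic gamma measurableT mB).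
  have mi : measurable_fun [set: T] (fun p => (\1_B p : R)%:E).
    by apply/measurable_EFinP; exact: measurable_indic.
  have i0 p : 0 <= (\1_B p : R)%:E by rewrite lee_fin.
  apply: le_trans (dom _ mi i0) _; rewrite (domq _ mi i0).
  rewrite [leRHS]integral_mkcond.
  by under [leRHS]eq_integral do rewrite epatch_indic muleC.
have gl : gamma `<< lebesgue_rV2 R d.
  apply/null_content_dominatesP => B mB B0; apply/eqP; rewrite eq_le measure_ge0 andbT.
  apply: le_trans (domB B mB) _.
  by rewrite null_set_integral//; exact: measurable_funTS.
have [D [Dd DE]] := density_exists gl.
rewrite (entropy_density gl Dd DE).
have [mD D0 iD] := Dd.
have iq : (lebesgue_rV2 R d).-integrable [set: T] (EFin \o q).
  apply/integrableP; split => //.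
  under eq_integral do rewrite gee0_abs ?lee_fin//.
  have m1 : measurable_fun [set: T] (fun=> 1 : \bar R) by exact: measurable_cst.
  have := domq (fun=> 1) m1 (fun=> lee01).
  under [X in _ = X -> _]eq_integral do rewrite mul1e.
  move=> <-.
  under eq_integral do rewrite integral_cst// mul1e.
  rewrite integral_cst// /= probability_setT mule1.
  exact: le_lt_trans nuN (ltry _).
have Dq : {ae gamma, forall p, (D p <= q p)%R}.
  apply: ae_dominates gl _; apply: ae_le_of_integral_le => //.
    exact: density_integrable Dd.
  by move=> B mB; rewrite -(density_measureE Dd)//; exact: domB.
have sN : \int[lebesgue_rV R d]_y (s y / N)%:E <= 1.
  under eq_integral do rewrite mulrC EFinM.
  rewrite ge0_integralZl//; last 3 first.
  - by apply/measurable_EFinP.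
  - by move=> y _; rewrite lee_fin.
  - by rewrite lee_fin invr_ge0 ltW.
  rewrite -(density_measureE sd)//.
  rewrite (_ : 1 = N^-1%:E * N%:E); last by rewrite -EFinM mulVf// gt_eqF.
  by rewrite lee_pmul2l// ?lte_fin ?invr_gt0// fin_numE.
have msN : measurable_fun [set: E] (fun y => s y / N)%R by apply: measurable_funM.
have sN0 y : (0 <= s y / N)%R by rewrite divr_ge0// ltW.
have [irat ratC] := ratio_integrable rd1 msN sN0 sN.
have g0 := coupling_fst_integrable cg il0.
have g1 := coupling_snd_integrable cg il1.
have g2 := coupling_snd_integrable cg irat.
have g3 : gamma.-integrable [set: T] (EFin \o cst (ln N - 1)%R).
  exact: finite_measure_integrable_cst.
(* [U] bounds [ln D]: write [ln s = ln N + ln (s / N)] and compare [s / N] with the density [r1] of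
   the second marginal. The mean of the ratio is at most 1 and is cancelled by the [-1]. *)
pose U (p : T) := ((ln (r0 p.1))%:E + (ln (r1 p.2))%:E) +
   ((s p.2 / N / r1 p.2)%:E + (ln N - 1)%:E).
have iU : gamma.-integrable [set: T] U.
  by apply: integrableD => //; apply: integrableD.
apply: (@le_trans _ _ (\int[gamma]_p U p)).
  apply: ae_le_integral; [|exact: measurable_int iU|].
    by apply/measurable_EFinP; apply: measurableT_comp => //; exact: measurable_ln.
  apply: filterS3 (density_gt0 Dd) Dq (coupling_ae_snd cg (density_gt0 rd1)) => p Dp Dqp r1p.
  have qp : (0 < q p)%R by exact: lt_le_trans Dqp.
  have r0p : (0 < r0 p.1)%R.
    by rewrite lt_neqAle r00 andbT; apply: contraTneq qp => h; rewrite /q -h mul0r ltxx.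
  have sp : (0 < s p.2)%R.
    by rewrite lt_neqAle s0 andbT; apply: contraTneq qp => h; rewrite /q -h mulr0 ltxx.
  have lD : (ln (D p) <= ln (r0 p.1) + ln (s p.2))%R.
    by rewrite -lnM// ler_ln.
  have := ln_le_ratio (divr_gt0 sp N0) r1p; rewrite ln_div// => lr.
  by rewrite /U -!EFinD lee_fin; lra.
rewrite /U integralD//; [|by apply: integrableD..].
rewrite integralD// [X in _ + X]integralD// (coupling_fst cg il0) (coupling_snd cg il1).
rewrite (coupling_snd cg irat) eq0 eq1 integral_cst//= probability_setT mule1.
rewrite [leRHS](_ : _ = H0%:E + H1%:E + (1%:E + (ln N - 1)%:E)); last first.
  by rewrite -!EFinD; congr EFin; ring.
by rewrite leeD2l// leeD2r.
Qed.

End entropy_upper_bound.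

(** * Replacing a coupling by products on cells *)

Section block_approximation.
Context {R : realType} {d : nat}.
Local Notation E := 'rV[R]_d.
Local Notation T := (E * E)%type.
Variables (mu0 mu1 : probability E R) (gamma : probability T R).
Hypothesis cg : couplings mu0 mu1 gamma.
Variables (K : finType) (kappa : T -> K).
Hypothesis mkappa : forall k, measurable (kappa @^-1` [set k]).

Lemma measurable_cell (k : K) : measurable_fun [set: T] (fun p => (kappa p == k)%:R : R).
Proof.
rewrite (_ : (fun p => _) = \1_(kappa @^-1` [set k])); last first.
  apply/funext => p; rewrite indicE; congr (_%:R).
  by congr nat_of_bool; apply/eqP/idP => [<-|]; rewrite inE.
exact: measurable_indic.
Qed.

Lemma sum_cell (k : K) (w : K -> R) : (\sum_j (k == j)%:R * w j = w k)%R.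
Proof.
rewrite (bigD1 k)//= eqxx mul1r big1 ?addr0// => j jk.
by rewrite eq_sym (negbTE jk) mul0r.
Qed.

Let a (k : K) : R := fine (gamma (kappa @^-1` [set k])).

Let aE k : (a k)%:E = gamma (kappa @^-1` [set k]).
Proof. by rewrite fineK// fin_num_measure. Qed.

Let a_ge0 k : (0 <= a k)%R.
Proof. by rewrite -lee_fin aE measure_ge0. Qed.

Let integral_cell1 (k : K) : \int[gamma]_p ((kappa p == k)%:R : R)%:E = (a k)%:E.
Proof.
rewrite aE -[in RHS](setIT (kappa @^-1` [set k])) -integral_indic//.
apply: eq_integral => p _; rewrite indicE; congr (_%:R%:E).
by congr nat_of_bool; apply/eqP/idP => [<-|]; rewrite inE.
Qed.

Let measurable_weight (w : K -> R) : measurable_fun [set: T] (fun p => w (kappa p)).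
Proof.
rewrite (_ : (fun p => _) = (fun p => \sum_j (kappa p == j)%:R * w j)%R); last first.
  by apply/funext => p; rewrite sum_cell.
by apply: measurable_sum => j; apply: measurable_funM => //; exact: measurable_cell.
Qed.

Let integral_weight (w : K -> R) : (forall k, 0 <= w k)%R ->
  \int[gamma]_p (w (kappa p))%:E = (\sum_k a k * w k)%:E.
Proof.
move=> w0; under eq_integral do rewrite -sum_cell -sumEFin.
rewrite ge0_integral_sum//; last 2 first.
- move=> k; apply/measurable_EFinP; apply: measurable_funM => //; exact: measurable_cell.
- by move=> k p _; rewrite lee_fin mulr_ge0.
rewrite -sumEFin; apply: eq_bigr => k _.
under eq_integral do rewrite mulrC EFinM.
rewrite ge0_integralZl ?integral_cell1 ?lee_fin//.
- by rewrite -EFinM mulrC.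
- by apply/measurable_EFinP; exact: measurable_cell.
Qed.

(** Cells of mass 0 cannot be normalised: there [G] vanishes, by the convention on inverses, and [g]
    leaves [gamma] unchanged. [G] is a sum over cells to make it evidently measurable and symmetric;
    [GE] is its closed form. *)
Let g (p : T) : R := (a (kappa p) == 0%R)%:R.
Let G (z : T * T) : R := (\sum_k (kappa z.1 == k)%:R * ((kappa z.2 == k)%:R / a k))%R.

Let GE p q : G (p, q) = ((kappa q == kappa p)%:R / a (kappa p))%R.
Proof. by rewrite /G/= (sum_cell _ (fun k => (kappa q == k)%:R / a k)%R). Qed.

Let GC p q : G (p, q) = G (q, p).
Proof. by rewrite /G/=; apply: eq_bigr => k _; rewrite mulrCA. Qed.

Let G_ge0 z : (0 <= G z)%R.
Proof. by apply: sumr_ge0 => k _; rewrite !mulr_ge0// invr_ge0. Qed.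

Let measurable_G : measurable_fun [set: T * T] G.
Proof.
apply: measurable_sum => k; apply: measurable_funM.
  exact: measurableT_comp (measurable_cell k) measurable_fst.
apply: measurable_funM => //.
exact: measurableT_comp (measurable_cell k) measurable_snd.
Qed.

Let integral_G p : \int[gamma]_q (G (p, q))%:E = (1 - g p)%:E.
Proof.
under eq_integral do rewrite GE mulrC EFinM.
rewrite ge0_integralZl ?integral_cell1 ?lee_fin ?invr_ge0//; last first.
  by apply/measurable_EFinP; exact: measurable_cell.
rewrite -EFinM /g; have [->|a0] := eqVneq (a (kappa p)) 0%R.
  by rewrite mulr0 subrr.
by rewrite mulVf// subr0.
Qed.

Let gg := product_sfm gamma gamma.
(** Up to cells of mass 0, this is the mean of [F (p, q)] for [p] of law [gamma] and [q] drawn from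
    the normalised restriction of [gamma] to the cell of [p]. *)
Let J (F : T * T -> R) := \int[gg]_z (F z * G z)%:E.

Let J_measurable (F : T * T -> R) : measurable_fun [set: T * T] F ->
  measurable_fun [set: T * T] (fun z => (F z * G z)%:E).
Proof. by move=> mF; apply/measurable_EFinP; exact: measurable_funM. Qed.

Let J_swap (F : T * T -> R) : measurable_fun [set: T * T] F -> (forall z, 0 <= F z)%R ->
  J (fun z => F (z.2, z.1)) = J F.
Proof.
move=> mF F0; have mFG := J_measurable mF.
have mFs : measurable_fun [set: T * T] (fun z => F (z.2, z.1)).
  by apply: (measurableT_comp mF); apply: measurable_fun_pair.
rewrite /J ge0_integral_product_sfm; [|exact: J_measurable|]; last first.
  by move=> z; rewrite lee_fin mulr_ge0.
rewrite /= ge0_integral_product_sfm; [|exact: mFG|]; last first.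
  by move=> z; rewrite lee_fin mulr_ge0.
have FG0 z : 0 <= (F z * G z)%:E by rewrite lee_fin mulr_ge0.
rewrite [RHS](@fubini_tonelli _ _ _ _ _ gamma gamma _ mFG FG0).
apply: eq_integral => p _; apply: eq_integral => q _ /=.
by rewrite GC.
Qed.

Let J_fst (f : T -> R) : measurable_fun [set: T] f -> (forall p, 0 <= f p)%R ->
  J (fun z => f z.1) <= \int[gamma]_p (f p)%:E.
Proof.
move=> mf f0; have mf1 : measurable_fun [set: T * T] (fun z => f z.1).
  exact: measurableT_comp mf measurable_fst.
rewrite /J ge0_integral_product_sfm; [|exact: J_measurable|]; last first.
  by move=> z; rewrite lee_fin mulr_ge0.
have mGE : measurable_fun [set: T * T] (EFin \o G) by apply/measurable_EFinP.
have fE p : \int[gamma]_q (f (p, q).1 * G (p, q))%:E = (f p * (1 - g p))%:E.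
  under eq_integral do rewrite /= EFinM.
  rewrite ge0_integralZl ?lee_fin// ?integral_G//.
    exact: (measurable_fun_pair2 p mGE).
  by move=> q _; rewrite lee_fin.
under eq_integral do rewrite fE.
have mg : measurable_fun [set: T] g by exact: (measurable_weight (fun k => (a k == 0%R)%:R)).
apply: ge0_le_integral => //.
- by move=> p _; rewrite lee_fin mulr_ge0// /g; case: eqP; rewrite /= ?subr0 ?subrr.
- apply/measurable_EFinP; apply: measurable_funM => //; exact: measurable_funB.
- by apply/measurable_EFinP.
- by move=> p _; rewrite lee_fin ler_piMr// gerBl /g.
Qed.

(* Exchanging the partners of [(x, y)] and [(x', y')] changes the cost by
   [<x - x', y - y'> <= |(x + y) - (x' + y')|^2 / 4], whether or not [gamma] is
   optimal: this is why the cells are cut along [x + y]. *)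
Let block_cost (Phi : T -> R) (h B : R) :
  measurable_fun [set: T] Phi -> (forall p, 0 <= Phi p)%R -> (0 <= h)%R ->
  (forall p q, kappa p = kappa q ->
    enorm ((p.1 + p.2) - (q.1 + q.2)) ^+ 2 <= h * (Phi p + Phi q))%R ->
  \int[gamma]_p (quadratic_cost p.1 p.2 + h / 4 * Phi p)%:E <= B%:E ->
  \int[gg]_z ((quadratic_cost z.1.1 z.2.2)%:E * (G z)%:E) <= B%:E.
Proof.
move=> mPhi Phi0 h0 hPhi hB.
pose f (p : T) := (quadratic_cost p.1 p.2 + h / 4 * Phi p)%R.
pose F (z : T * T) : R := quadratic_cost z.1.1 z.2.2.
have f0 p : (0 <= f p)%R.
  by rewrite addr_ge0 ?quadratic_cost_ge0// mulr_ge0// divr_ge0.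
have F0 z : (0 <= F z)%R by exact: quadratic_cost_ge0.
have mf : measurable_fun [set: T] f.
  apply: measurable_funD; first exact: measurable_quadratic_cost.
  exact: measurable_funM.
have mF : measurable_fun [set: T * T] F.
  apply: (measurableT_comp (@measurable_quadratic_cost R d)
    (g := fun z : T * T => (z.1.1, z.2.2))).
  apply: measurable_fun_pair; first exact: measurableT_comp measurable_fst measurable_fst.
  exact: measurableT_comp measurable_snd measurable_snd.
have mf1 : measurable_fun [set: T * T] (fun z => f z.1).
  exact: measurableT_comp mf measurable_fst.
have mf2 : measurable_fun [set: T * T] (fun z => f z.2).
  exact: measurableT_comp mf measurable_snd.
have mFs : measurable_fun [set: T * T] (fun z => F (z.2, z.1)).
  by apply: (measurableT_comp mF); apply: measurable_fun_pair.
have JD (u v : T * T -> R) : measurable_fun [set: T * T] u -> (forall z, 0 <= u z)%R ->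
    measurable_fun [set: T * T] v -> (forall z, 0 <= v z)%R ->
    J u + J v = J (fun z => u z + v z)%R.
  move=> mu u0 mv v0; rewrite /J.
  rewrite -ge0_integralD//; [|by move=> z _; rewrite lee_fin mulr_ge0|exact: J_measurable|
    by move=> z _; rewrite lee_fin mulr_ge0|exact: J_measurable].
  by apply: eq_integral => z _; rewrite mulrDl EFinD.
(* The law of the pair is symmetric, so [F] may be averaged with its swap; this produces both
   exchanged costs at once, and polarisation compares their sum with the two original costs. *)
have le2 : J F + J F <= B%:E + B%:E.
  rewrite -[X in X + _]J_swap// JD//.
  apply: (@le_trans _ _ (J (fun z => f z.1 + f z.2)%R)).
    apply: ge0_le_integral => //.
    - by move=> z _; rewrite lee_fin mulr_ge0// addr_ge0.
    - by apply: J_measurable; exact: measurable_funD.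
    - by apply: J_measurable; exact: measurable_funD.
    move=> [p q] _ /=; rewrite lee_fin GE.
    have [kqp|] := eqVneq (kappa q) (kappa p); last by rewrite mul0r !mulr0.
    rewrite ler_wpM2r// ?mulr_ge0 ?invr_ge0//.
    have := hPhi p q (esym kqp).
    have : (F (q, p) + F (p, q) <= quadratic_cost p.1 p.2 + quadratic_cost q.1 q.2 +
        4^-1 * enorm ((p.1 + p.2) - (q.1 + q.2))%R ^+ 2)%R.
      rewrite /F/= enorm_sqr !quadratic_costE -!mulrDr -!big_split/= !mulr_sumr -big_split/=.
      apply: ler_sum => i _; rewrite !mxE -subr_ge0.
      rewrite (_ : (_ - _)%R = 4^-1 * ((p.1 ord0 i - q.1 ord0 i) - (p.2 ord0 i - q.2 ord0 i)) ^+ 2)%R;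
        last by field.
      by rewrite mulr_ge0 ?sqr_ge0// invr_ge0.
    by rewrite /f; lra.
  rewrite -JD//; apply: leeD.
    by apply: le_trans hB; exact: J_fst.
  rewrite (_ : J _ = J (fun z => f z.1)); last by rewrite -(J_swap mf1).
  by apply: le_trans hB; exact: J_fst.
have -> : \int[gg]_z ((quadratic_cost z.1.1 z.2.2)%:E * (G z)%:E) = J F by [].
have JF0 : 0 <= J F by apply: integral_ge0 => z _; rewrite lee_fin mulr_ge0.
move: (J F) JF0 le2 => [r| |]//= _.
by rewrite -!EFinD !lee_fin; lra.
Qed.

(* In each cell [kappa = k], [gamma] is replaced by the product of the marginals
   of its restriction; it is dominated by [mu0 \x nu], where [nu] weights the
   second marginal of each cell by the inverse of its mass, hence has mass at
   most the number of cells. *)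
Lemma block_approximation : exists gamma' : probability T R,
  [/\ couplings mu0 mu1 gamma',
   (forall (Phi : T -> R) (h B : R),
     measurable_fun [set: T] Phi -> (forall p, 0 <= Phi p)%R -> (0 <= h)%R ->
     (forall p q, kappa p = kappa q ->
       enorm ((p.1 + p.2) - (q.1 + q.2)) ^+ 2 <= h * (Phi p + Phi q))%R ->
     \int[gamma]_p (quadratic_cost p.1 p.2 + h / 4 * Phi p)%:E <= B%:E ->
     transport_cost (@quadratic_cost R d) gamma' <= B%:E) &
   exists nu : {finite_measure set E -> \bar R},
     [/\ nu `<< mu1, nu setT <= #|K|%:R%:E &
      forall f : T -> \bar R, measurable_fun [set: T] f -> (forall p, 0 <= f p) ->
        \int[gamma']_p f p <= \int[mu0]_x \int[nu]_y f (x, y)]].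
Proof.
have mg : measurable_fun [set: T] g by exact: (measurable_weight (fun k => (a k == 0%R)%:R)).
have mGE : measurable_fun [set: T * T] (EFin \o G) by apply/measurable_EFinP.
have g0 p : (0 <= g p)%R by rewrite /g.
have hg p : (g p)%:E + \int[gamma]_q (G (p, q))%:E = 1.
  by rewrite integral_G -EFinD subrKC.
have [|gamma' [cg' gE]] := @resampling _ _ _ _ _ cg g G mg measurable_G g0 G_ge0 hg.
  by move=> q; under eq_integral do rewrite GC; exact: hg.
(* Finitely many cells of mass 0 form a null set, so the part left in place disappears from the
   integrals. *)
have g_eq0 : ae_eq gamma setT (EFin \o g) (cst 0).
  apply/(ae_eq_integral_abs gamma measurableT); first exact/measurable_EFinP.
  under eq_integral do rewrite gee0_abs ?lee_fin//.
  rewrite (@integral_weight (fun k => (a k == 0%R)%:R))// big1// => k _.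
  by have [->|] := eqVneq (a k) 0%R; rewrite ?mul0r ?mulr0.
have gE' (f : T -> \bar R) : measurable_fun [set: T] f -> (forall p, 0 <= f p) ->
    \int[gamma']_p f p =
    \int[gamma]_p \int[gamma]_q (f (p.1, q.2) * (G (p, q))%:E).
  move=> mf f0; rewrite gE// (ae_eq_integral (cst 0)) ?integral0 ?add0e//.
  - by apply: emeasurable_funM => //; exact/measurable_EFinP.
  - by apply: filterS g_eq0 => p /= gp _; rewrite gp// mule0.
exists gamma'; split=> //.
  move=> Phi h B mPhi Phi0 h0 hPhi hB.
  apply: le_trans (block_cost mPhi Phi0 h0 hPhi hB).
  have mc : measurable_fun [set: T] (fun p : T => (quadratic_cost p.1 p.2)%:E).
    by apply/measurable_EFinP; exact: measurable_quadratic_cost.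
  rewrite /transport_cost gE'//; last by move=> p; rewrite lee_fin quadratic_cost_ge0.
  rewrite ge0_integral_product_sfm//=.
  - apply: emeasurable_funM => //.
    apply: (measurableT_comp mc (g := fun z : T * T => (z.1.1, z.2.2))).
    apply: measurable_fun_pair; first exact: measurableT_comp measurable_fst measurable_fst.
    exact: measurableT_comp measurable_snd measurable_snd.
  - by move=> z; rewrite mule_ge0// lee_fin// quadratic_cost_ge0.
(* Each cell of positive mass contributes exactly 1 to the integral of [W], which therefore counts
   such cells. *)
pose W (q : T) : R := (a (kappa q))^-1%R.
have mW : measurable_fun [set: T] (EFin \o W).
  by apply/measurable_EFinP; exact: (measurable_weight (fun k => (a k)^-1%R)).
have W0 q : 0 <= (EFin \o W) q by rewrite lee_fin invr_ge0.
have intW : \int[gamma]_q (W q)%:E <= #|K|%:R%:E.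
  rewrite (@integral_weight (fun k => (a k)^-1%R)); last by move=> k; rewrite invr_ge0.
  rewrite lee_fin -sum1_card natr_sum; apply: ler_sum => k _.
  by have [->|a0] := eqVneq (a k) 0%R; rewrite ?mul0r// mulfV.
have iW : gamma.-integrable [set: T] (EFin \o W).
  apply/integrableP; split => //.
  under eq_integral do rewrite gee0_abs//.
  exact: le_lt_trans intW (ltry _).
have [nu1 [nu1m nu1E]] := density_measure W0 iW.
pose nu2 : {measure set E -> \bar R} :=
  measure_function_pushforward__canonical__measure_function_Measure nu1
    (measurable_snd : measurable_fun [set: T] (snd : T -> E)).
have nu2T : nu2 setT = \int[gamma]_q (W q)%:E.
  by rewrite /nu2/= /pushforward preimage_setT nu1m.
have [|nu nuE] := @finite_measure_of_measure _ _ _ nu2.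
  by rewrite nu2T; exact: le_lt_trans intW (ltry _).
exists nu; split.
- apply/null_content_dominatesP => A mA A0; rewrite nuE /nu2/= /pushforward.
  have mA2 : measurable (snd @^-1` A : set T).
    by rewrite -[X in measurable X]setTI; exact: measurable_snd.
  rewrite nu1m// null_set_integral//; first exact: measurable_funTS.
  by have [_] := cg mA; rewrite A0.
- by rewrite nuE nu2T.
move=> f mf f0; rewrite gE'//.
have nuint x : \int[nu]_y f (x, y) = \int[gamma]_q (f (x, q.2) * (W q)%:E).
  have mfx := measurable_fun_pair2 x mf.
  transitivity (\int[nu2]_y f (x, y)).
    by apply: eq_measure_integral => A _ _; exact: nuE.
  have mf2 : measurable_fun [set: T] (fun q => f (x, q.2)).
    exact: measurableT_comp mfx measurable_snd.
  rewrite -(nu1E (fun q => f (x, q.2)))// /nu2 (ge0_integral_pushforward measurable_snd)//.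
have mnu : measurable_fun [set: E] (fun x => \int[nu]_y f (x, y)).
  exact: (@measurable_fun_fubini_tonelli_F _ _ _ _ _ nu _ mf).
rewrite -(coupling_fst_ge0 cg mnu); last by move=> x; exact: integral_ge0.
have mfG : measurable_fun [set: T * T] (fun z => f (z.1.1, z.2.2)).
  apply: (measurableT_comp mf); apply: measurable_fun_pair.
    exact: measurableT_comp measurable_fst measurable_fst.
  exact: measurableT_comp measurable_snd measurable_snd.
apply: ge0_le_integral => //.
- by move=> p _; apply: integral_ge0 => q _; rewrite mule_ge0// lee_fin.
- have mF : measurable_fun [set: T * T] (fun z => f (z.1.1, z.2.2) * (G z)%:E).
    exact: emeasurable_funM.
  have := @measurable_fun_fubini_tonelli_F _ _ _ _ _ gamma _ mF.
  by apply => z; rewrite mule_ge0// lee_fin.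
- exact: measurableT_comp mnu measurable_fst.
move=> p _; rewrite nuint; apply: ge0_le_integral => //.
- by move=> q _; rewrite mule_ge0// lee_fin.
- apply: emeasurable_funM; last exact: (measurable_fun_pair2 p mGE).
  exact: (measurable_fun_pair2 p mfG).
- by apply: emeasurable_funM => //; exact: (measurable_fun_pair2 p mfG).
(* [G (p, q)] is [W q] if the two points share a cell and 0 otherwise; dropping this restriction
   decouples [p] from [q]. *)
- move=> q _; rewrite lee_wpmul2l// lee_fin GC GE /W.
  by case: (kappa p == kappa q); rewrite ?mul1r// mul0r invr_ge0.
Qed.

End block_approximation.

(** * A grid adapted to moments of order [2 + delta] *)

Section grid.
Context {R : realType}.
Variable delta : R.
Hypothesis delta0 : (0 < delta)%R.
Let theta : R := (delta / 2)%R.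
Let theta0 : (0 < theta)%R.
Proof. by rewrite divr_gt0. Qed.

(* A grid that is uniform after applying the bounded function [F] has boundedly
   many cells per step, and [F' = theta (1 + t)^(-1 - theta)] makes the squared
   size of a cell integrable exactly under a moment of order [2 + delta]. *)
Let F (t : R) : R := (1 - (1 + t) `^ (- theta))%R.

Let F_ge0 (t : R) : (0 <= t)%R -> (0 <= F t)%R.
Proof.
move=> t0; rewrite subr_ge0 powRN invf_le1 ?powR_gt0 ?ltr_pwDl//.
by rewrite -[leLHS](powRr0 (1 + t)%R) ler_powR ?lerDl// ltW.
Qed.

Let F_lt1 (t : R) : (0 <= t)%R -> (F t < 1)%R.
Proof. by move=> t0; rewrite ltrBlDr ltrDl powR_gt0// ltr_pwDl. Qed.

(** By concavity the slope of [F] on [[s, t]] is at least its derivative at [t]. This is derived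
    without differentiation, from [ln (1 + x) <= x] and [1 + x <= expR x]. *)
Let F_incr (s t : R) : (0 <= s <= t)%R ->
  (theta * (t - s) <= (F t - F s) * (1 + t) `^ (1 + theta))%R.
Proof.
move=> /andP[s0 st]; have t0 := le_trans s0 st.
have p1 : (0 < 1 + s)%R by rewrite ltr_pwDl.
have p2 : (0 < 1 + t)%R by rewrite ltr_pwDl.
have r0 : (0 < (1 + t) / (1 + s))%R by rewrite divr_gt0.
have -> : ((F t - F s) * (1 + t) `^ (1 + theta) =
    (1 + t) * (((1 + t) / (1 + s)) `^ theta - 1))%R.
  rewrite /F powRD; last by apply/implyP => _; rewrite gt_eqF.
  rewrite powRr1 ?ltW// powRM ?ltW ?invr_gt0// -(powR_inv1 (ltW p1)) -powRrM mulN1r.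
  have e2 : ((1 + t) `^ theta != 0)%R by rewrite gt_eqF ?powR_gt0.
  have e1 : ((1 + s) `^ theta != 0)%R by rewrite gt_eqF ?powR_gt0.
  by rewrite !powRN; field; rewrite e1 e2.
have lr : ((t - s) / (1 + t) <= ln ((1 + t) / (1 + s)))%R.
  have := @le_ln1Dx R ((1 + s) / (1 + t) - 1)%R.
  rewrite subrKC ltrBrDl subrr divr_gt0// => /(_ isT).
  rewrite !ln_div// (_ : ((1 + s) / (1 + t) - 1 = - ((t - s) / (1 + t)))%R); first lra.
  by field; rewrite gt_eqF.
have : (1 + theta * ((t - s) / (1 + t)) <= ((1 + t) / (1 + s)) `^ theta)%R.
  rewrite /powR gt_eqF//; apply: le_trans (expR_ge1Dx _).
  by rewrite lerD2l ler_pM2l.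
rewrite -lerBrDl => h.
rewrite -(ler_pM2l p2) in h; apply: le_trans h.
by rewrite le_eqVlt; apply/orP; left; apply/eqP; field; rewrite gt_eqF.
Qed.

(** Square [F_incr] at the larger point: since [theta = delta / 2], the exponent [2 * (1 + theta)]
    is [2 + delta]. Adding the term of the smaller point makes the bound symmetric. *)
Let F_cell (n s t : R) : (0 < n)%R -> (0 <= s)%R -> (0 <= t)%R -> (`|F s - F t| <= n^-1)%R ->
  ((s - t) ^+ 2 <= (theta * n) ^- 2 *
     ((1 + s) `^ (2 + delta) + (1 + t) `^ (2 + delta)))%R.
Proof.
move=> n0; wlog st : s t / (s <= t)%R.
  move=> h s0 t0 st; have [|ts] := leP s t; first by move/h; exact.
  have := h t s (ltW ts) t0 s0; rewrite distrC => /(_ st).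
  by rewrite -[in X in X -> _]sqrrN opprB [in X in X -> _](addrC (_ `^ _)%R).
move=> s0 t0 Fst.
have inc : (theta * (t - s) <= n^-1 * (1 + t) `^ (1 + theta))%R.
  apply: le_trans (F_incr _) _; first by rewrite s0.
  by rewrite ler_wpM2r ?powR_ge0// (le_trans _ Fst)// distrC ler_norm.
have tn0 : (0 < theta * n)%R by rewrite mulr_gt0.
have sq : ((1 + t) `^ (2 + delta) = ((1 + t) `^ (1 + theta)) ^+ 2)%R.
  rewrite -powR_mulrn ?powR_ge0// -powRrM; congr (_ `^ _)%R.
  by rewrite /theta; field.
rewrite sq; apply: (@le_trans _ _ ((theta * n) ^- 2 * ((1 + t) `^ (1 + theta)) ^+ 2)%R).
  rewrite -exprVn -exprMn -sqrrN opprB ler_sqr ?nnegrE ?subr_ge0//; last first.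
    by rewrite mulr_ge0 ?powR_ge0// invr_ge0 ltW.
  rewrite ler_pdivlMl// (mulrC theta) -mulrA.
  by rewrite -ler_pdivlMl.
by rewrite ler_wpM2l ?lerDr ?powR_ge0// invr_ge0 exprn_ge0// ltW.
Qed.

Variable m : nat.
Let n : R := m.+1%:R.
Let n0 : (0 < n)%R. Proof. by rewrite ltr0n. Qed.

(** Recording the sign reduces [s - t] to [|s| - |t|] inside a cell. As [F < 1], the truncation
    stays below [m.+1], so [inord] never returns its default value. *)
Let cell (t : R) : bool * 'I_m.+1 := ((t < 0)%R, inord (Num.truncn (n * F `|t|)%R)).

Let nF_ge0 (t : R) : (0 <= n * F `|t|)%R.
Proof. by rewrite mulr_ge0 ?F_ge0// ltW. Qed.

Let truncn_lt (t : R) : (Num.truncn (n * F `|t|)%R < m.+1)%N.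
Proof. by rewrite truncn_lt_nat// gtr_pMr// F_lt1. Qed.

Let measurable_cell1 b : measurable (cell @^-1` [set b]).
Proof.
have mF : measurable_fun [set: R] (fun t : R => n * F `|t|)%R.
  apply: measurable_funM => //; apply: measurable_funB => //.
  apply: (measurableT_comp (measurable_powR (- theta)%R)).
  by apply: measurable_funD.
have -> : cell @^-1` [set b] =
    [set t | (t < 0)%R = b.1] `&`
    (fun t : R => n * F `|t|)%R @^-1` `[(b.2 : nat)%:R, (b.2 : nat).+1%:R[%classic.
  apply/seteqP; split => [t /= <-|t /= [tb]].
    split => //; rewrite in_itv/= inordK ?truncn_lt//; exact: truncn_itv.
  rewrite in_itv/= => /truncn_def ti; rewrite /cell ti tb.
  by case: b {tb ti} => b1 b2 /=; rewrite inord_val.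
apply: measurableI.
  have m0 : measurable_fun [set: R] (fun t : R => (t < 0)%R).
    by apply: measurable_fun_ltr.
  by have := m0 measurableT [set b.1] I; rewrite setTI.
by have := mF measurableT _ (measurable_itv `[(b.2 : nat)%:R, (b.2 : nat).+1%:R[); rewrite setTI.
Qed.

Let cell_close (s t : R) : cell s = cell t ->
  ((s - t) ^+ 2 <= (theta * n) ^- 2 *
     ((1 + `|s|) `^ (2 + delta) + (1 + `|t|) `^ (2 + delta)))%R.
Proof.
move=> [sg] /(congr1 val) /=; rewrite !inordK ?truncn_lt// => tr.
have -> : ((s - t) ^+ 2 = (`|s| - `|t|) ^+ 2)%R.
  case: (ltP s 0%R) sg => [s0|s0] /esym; case: (ltP t 0%R) => // t0 _.
    by rewrite !ltr0_norm// -sqrrN; congr (_ ^+ 2)%R; ring.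
  by rewrite !ger0_norm.
apply: F_cell => //.
have /andP[s1 s2] := truncn_itv (nF_ge0 s); have /andP[t1 t2] := truncn_itv (nF_ge0 t).
rewrite tr in s1 s2; rewrite -(ler_pM2l n0) mulfV ?gt_eqF//.
rewrite -[X in (X * _)%R](gtr0_norm n0) -normrM mulrBr ler_norml.
move: s1 s2 t1 t2; rewrite -!natr1; move: (_%:R)%R => k.
by move=> *; apply/andP; split; lra.
Qed.

Context (d : nat).
Local Notation E := 'rV[R]_d.

Definition grid_weight (u : E) : R := (\sum_(i < d) (1 + `|u ord0 i|) `^ (2 + delta))%R.

(** The one-dimensional grid is used in every coordinate, which gives [(2 * m.+1) ^ d] labels. *)
Lemma grid_exists : exists kappa : E -> {ffun 'I_d -> bool * 'I_m.+1},
  (forall k, measurable (kappa @^-1` [set k])) /\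
  forall u u', kappa u = kappa u' ->
    (enorm (u - u') ^+ 2 <= (delta / 2 * m.+1%:R) ^- 2 * (grid_weight u + grid_weight u'))%R.
Proof.
exists (fun u => [ffun i => cell (u ord0 i)]); split.
  move=> k.
  rewrite (_ : _ @^-1` _ = \bigcap_(i in [set: 'I_d])
      ((fun u : E => u ord0 i) @^-1` (cell @^-1` [set k i]))).
    apply: fin_bigcap_measurable => // i _.
    rewrite -[X in measurable X]setTI.
    exact: (measurable_rV_entry i).
  apply/seteqP; split => [u /= <- i _|u /= h]; first by rewrite /= ffunE.
  by apply/ffunP => i; rewrite ffunE; exact: (h i I).
move=> u u' /ffunP kE; rewrite enorm_sqr /grid_weight -big_split/= mulr_sumr.
apply: ler_sum => i _; rewrite !mxE; apply: cell_close.
by have := kE i; rewrite !ffunE.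
Qed.

End grid.

Section competitor.
Context {R : realType} {d : nat}.
Local Notation E := 'rV[R]_d.
Local Notation T := (E * E)%type.
Variable delta : R.
Hypothesis delta0 : (0 < delta)%R.

Let measurable_enorm_powR : measurable_fun [set: E] (fun x : E => (enorm x `^ (2 + delta))%:E).
Proof.
apply/measurable_EFinP; apply: (measurableT_comp (measurable_powR _)).
exact: measurable_enorm.
Qed.

Lemma second_moment_le (mu : probability E R) (M : R) :
  moment (2 + delta)%R mu = M%:E -> \int[mu]_x (enorm x ^+ 2)%:E <= (1 + M)%:E.
Proof.
move=> hM.
apply: (@le_trans _ _ (\int[mu]_x (1 + (enorm x `^ (2 + delta))%:E))).
  apply: ge0_le_integral => //.
  - by move=> x _; rewrite lee_fin sqr_ge0.
  - exact: measurable_sqr_enorm.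
  - exact: emeasurable_funD.
  - move=> x _; rewrite -EFinD lee_fin.
    have [x1|x1] := leP (enorm x) 1%R.
      by rewrite (@le_trans _ _ 1%R) ?lerDl ?powR_ge0// exprn_ile1 ?enorm_ge0.
    rewrite (@le_trans _ _ (enorm x `^ (2 + delta))%R) ?lerDr//.
    by rewrite -powR_mulrn ?enorm_ge0// ler_powR ?ltW// ltrDl.
rewrite ge0_integralD//; last by move=> x _; rewrite lee_fin powR_ge0.
by rewrite integral_cst//= probability_setT mule1 EFinD leeD2l// -hM.
Qed.

Lemma moment_ge0 (mu : probability E R) (M : R) :
  moment (2 + delta)%R mu = M%:E -> (0 <= M)%R.
Proof.
by move=> hM; rewrite -lee_fin -hM integral_ge0// => x _; rewrite lee_fin powR_ge0.
Qed.

Variables (mu0 mu1 : probability E R) (gamma : probability T R) (M0 M1 : R).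
Hypothesis cg : couplings mu0 mu1 gamma.
Hypotheses (hM0 : moment (2 + delta)%R mu0 = M0%:E) (hM1 : moment (2 + delta)%R mu1 = M1%:E).

(** The 3 comes from [1 + |x_i + y_i| <= 3 * max (1, |x|, |y|)], and [d] counts the coordinates. *)
Definition grid_weight_const (M : R) : R := (d%:R * 3 `^ (2 + delta) * (1 + M))%R.

Let entry_le (x : E) i : (`|x ord0 i| <= enorm x)%R.
Proof.
rewrite -ler_sqr ?nnegrE ?enorm_ge0// real_normK ?num_real// enorm_sqr.
by rewrite (bigD1 i)//= lerDl sumr_ge0// => j _; exact: sqr_ge0.
Qed.

Let measurable_grid_weight : measurable_fun [set: T] (fun p : T => grid_weight delta (p.1 + p.2)%R).
Proof.
apply: measurable_sum => i; apply: (measurableT_comp (measurable_powR _)).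
apply: measurable_funD => //.
exact: measurableT_comp (@normr_measurable R setT)
  (measurableT_comp (measurable_rV_entry i) (@measurable_rV_add R d)).
Qed.

Let grid_weight_ge0 (u : E) : (0 <= grid_weight delta u)%R.
Proof. by apply: sumr_ge0 => i _; exact: powR_ge0. Qed.

Let grid_weight_le (x y : E) : (grid_weight delta (x + y) <=
  d%:R * 3 `^ (2 + delta) * (1 + enorm x `^ (2 + delta) + enorm y `^ (2 + delta)))%R.
Proof.
rewrite -mulrA; set C := (3 `^ _ * _)%R.
have <- : (\sum_(i < d) C = d%:R * C)%R by rewrite sumr_const card_ord mulr_natl.
apply: ler_sum => i _; rewrite /C {C}.
have p0 : (0 <= 2 + delta)%R by rewrite addr_ge0 ?ltW.
pose M := Num.max 1%R (Num.max (enorm x) (enorm y)).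
have M0' : (0 <= M)%R by rewrite le_max ler01.
have pow_le (a b : R) : (0 <= a)%R -> (a <= b)%R -> (a `^ (2 + delta) <= b `^ (2 + delta))%R.
  by move=> a0 ab; apply: ge0_ler_powR => //; rewrite nnegrE// (le_trans a0).
apply: (@le_trans _ _ ((3 * M) `^ (2 + delta))%R).
  apply: pow_le; first by rewrite addr_ge0.
  rewrite mxE; have := ler_normD (x ord0 i) (y ord0 i).
  have := entry_le x i; have := entry_le y i.
  have : (1 <= M)%R by rewrite le_max lexx.
  have : (enorm x <= M)%R by rewrite !le_max lexx orbT.
  have : (enorm y <= M)%R by rewrite !le_max lexx !orbT.
  lra.
rewrite powRM// ler_wpM2l ?powR_ge0//.
have := powR_ge0 (enorm x) (2 + delta)%R; have := powR_ge0 (enorm y) (2 + delta)%R.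
rewrite /M; case: (leP 1%R) => _; last by rewrite powR1; lra.
by case: (leP (enorm x)) => _; lra.
Qed.

Let integral_grid_weight :
  \int[gamma]_p (grid_weight delta (p.1 + p.2)%R)%:E <= (grid_weight_const (M0 + M1))%:E.
Proof.
pose A : R := (d%:R * 3 `^ (2 + delta))%R.
have A0 : (0 <= A)%R by rewrite mulr_ge0 ?powR_ge0.
have m0 := measurable_enorm_powR.
have m1 : measurable_fun [set: T] (fun p : T => (enorm p.1 `^ (2 + delta))%:E).
  exact: measurableT_comp m0 measurable_fst.
have m2 : measurable_fun [set: T] (fun p : T => (enorm p.2 `^ (2 + delta))%:E).
  exact: measurableT_comp m0 measurable_snd.
have p0 (x : E) : 0 <= (enorm x `^ (2 + delta))%:E by rewrite lee_fin powR_ge0.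
apply: (@le_trans _ _ (\int[gamma]_p (A%:E *
    (1 + (enorm p.1 `^ (2 + delta))%:E + (enorm p.2 `^ (2 + delta))%:E)))).
  apply: ge0_le_integral => //.
  - by move=> p _; rewrite lee_fin.
  - by apply/measurable_EFinP.
  - by apply: emeasurable_funM => //; do 2 apply: emeasurable_funD => //.
  - by move=> p _; rewrite -!EFinD -EFinM lee_fin grid_weight_le.
rewrite ge0_integralZl//; last 2 first.
- by do 2 apply: emeasurable_funD => //.
- by move=> p _; rewrite !adde_ge0.
rewrite ge0_integralD//; last 2 first.
- by move=> p _; rewrite adde_ge0.
- by apply: emeasurable_funD.
rewrite ge0_integralD// integral_cst//= probability_setT mule1.
rewrite (coupling_fst_ge0 cg m0 p0) (coupling_snd_ge0 cg m0 p0).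
rewrite [X in 1 + X + _](_ : _ = M0%:E)// [X in _ + X](_ : _ = M1%:E)//.
by rewrite -!EFinD -EFinM lee_fin /grid_weight_const addrA.
Qed.

Variables (H0 H1 c : R).
Hypotheses (mu0l : mu0 `<< lebesgue_rV R d) (mu1l : mu1 `<< lebesgue_rV R d).
Hypotheses (eH0 : entropy (lebesgue_rV R d) mu0 = H0%:E)
  (eH1 : entropy (lebesgue_rV R d) mu1 = H1%:E).
Hypothesis hc : transport_cost (@quadratic_cost R d) gamma = c%:E.

(** The block approximation is applied to the grid cells of [x + y], with the grid weight as [Phi]:
    the mesh enters the cost and the logarithm of the number of cells enters the entropy. *)
Lemma competitor (m : nat) : exists gamma' : probability T R,
  [/\ couplings mu0 mu1 gamma',
   transport_cost (@quadratic_cost R d) gamma' <=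
     (c + (delta / 2 * m.+1%:R) ^- 2 / 4 * grid_weight_const (M0 + M1))%:E &
   entropy (lebesgue_rV2 R d) gamma' <= (H0 + H1 + d%:R * ln (2 * m.+1%:R))%:E].
Proof.
have [kap [mk kapP]] := grid_exists delta0 m d.
pose K := {ffun 'I_d -> bool * 'I_m.+1}.
pose kappa (p : T) : K := kap (p.1 + p.2)%R.
have mkappa k : measurable (kappa @^-1` [set k]).
  have := @measurable_rV_add R d measurableT _ (mk k); rewrite setTI; exact.
have [gamma' [cg' cost' [nu [numu1 nuK dom]]]] := block_approximation cg mkappa.
exists gamma'; split => //.
  apply: (cost' (fun p => grid_weight delta (p.1 + p.2)%R) ((delta / 2 * m.+1%:R) ^- 2)%R _
    measurable_grid_weight) => //.
  - by rewrite invr_ge0 exprn_ge0// mulr_ge0// divr_ge0// ltW.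
  - by move=> p q; exact: kapP.
  - have h0 : (0 <= (delta / 2 * m.+1%:R) ^- 2 / 4 :> R)%R.
      by rewrite divr_ge0// invr_ge0 exprn_ge0// mulr_ge0// divr_ge0// ltW.
    move: (_ ^- 2 / 4)%R h0 => h h0.
    under eq_integral do rewrite EFinD (EFinM h).
    have mw : measurable_fun [set: T] (fun p : T => (grid_weight delta (p.1 + p.2)%R)%:E).
      by apply/measurable_EFinP.
    rewrite ge0_integralD//; last 4 first.
    - by move=> p _; rewrite lee_fin quadratic_cost_ge0.
    - by apply/measurable_EFinP; exact: measurable_quadratic_cost.
    - by move=> p _; rewrite mule_ge0// lee_fin.
    - exact: emeasurable_funM.
    rewrite ge0_integralZl//; last by move=> p _; rewrite lee_fin.
    rewrite -[X in X + _]/(transport_cost (@quadratic_cost R d) gamma) hc EFinD leeD2l// (EFinM h).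
    by rewrite lee_wpmul2l ?lee_fin.
have nul : nu `<< lebesgue_rV R d by exact: null_dominates_trans numu1 mu1l.
have cardK : #|{: K}| = ((2 * m.+1) ^ d)%N.
  by rewrite card_ffun card_prod card_bool !card_ord.
have K0 : (0 < #|{: K}|%:R :> R)%R by rewrite ltr0n cardK expn_gt0.
have := entropy_upper_bound cg' mu0l mu1l nul eH0 eH1 K0 nuK dom.
by rewrite cardK natrX lnXn ?ltr0n// natrM [(d%:R * _)%R]mulr_natl.
Qed.

End competitor.

(** * Kantorovich duality *)

Section boxes.
Context {R : realType} {d : nat}.
Local Notation E := 'rV[R]_d.
Local Notation T := (E * E)%type.

Definition box (x : E) (r : R) : set E :=
  [set y | forall i, (`|y ord0 i - x ord0 i| < r)%R].

Lemma box_center (x : E) (r : R) : (0 < r)%R -> box x r x.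
Proof. by move=> r0 i; rewrite subrr normr0. Qed.

Lemma box_sub (x : E) (r s : R) : (r <= s)%R -> box x r `<=` box x s.
Proof. by move=> rs y xy i; exact: lt_le_trans (xy i) rs. Qed.

Lemma measurable_box (x : E) (r : R) : measurable (box x r).
Proof.
rewrite (_ : box x r = \bigcap_(i in [set: 'I_d])
    ((fun u : E => u ord0 i) @^-1` `](x ord0 i - r)%R, (x ord0 i + r)%R[)).
  apply: fin_bigcap_measurable => // i _.
  by have := measurable_rV_entry i measurableT
    (measurable_itv `](x ord0 i - r)%R, (x ord0 i + r)%R[); rewrite setTI.
by apply/seteqP; split => [y xy i _ /=|y xy i];
  [|have /= := xy i I]; rewrite in_itv/= -ltr_distl.
Qed.

Lemma rational_box (x : E) (r : R) : (0 < r)%R ->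
  exists (q : 'rV[rat]_d) (k : nat),
    box (map_mx ratr q) k.+1%:R^-1 x /\ box (map_mx ratr q) k.+1%:R^-1 `<=` box x r.
Proof.
move=> r0; pose k := Num.truncn (2 / r)%R.
have k0 : (0 < k.+1%:R^-1 :> R)%R by rewrite invr_gt0 ltr0n.
have kr : (k.+1%:R^-1 < r / 2 :> R)%R.
  rewrite -[ltRHS]invrK ltf_pV2 ?posrE ?ltr0n ?invr_gt0 ?divr_gt0//.
  by rewrite invf_div truncnS_gt.
have hq i : exists q : rat, (`|x ord0 i - ratr q| < k.+1%:R^-1)%R.
  have h : (x ord0 i - k.+1%:R^-1 < x ord0 i + k.+1%:R^-1)%R.
    by rewrite ltrBlDr -addrA ltrDl addr_gt0.
  have [q] := rat_in_itvoo h.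
  by rewrite in_itv/= -ltr_distl distrC; exists q.
have [q qP] := fin_all_exists hq.
exists (\row_i q i), k; split => [i|y hy i]; first by rewrite !mxE.
have := hy i; rewrite !mxE => yi; have xi := qP i.
rewrite (_ : _ - _ = (y ord0 i - ratr (q i)) - (x ord0 i - ratr (q i)))%R; last by ring.
apply: le_lt_trans (ler_normB _ _) _; move: (k.+1%:R^-1)%R kr yi xi => s; lra.
Qed.

Definition box_open (U : set E) : Prop :=
  forall x, U x -> exists2 r, (0 < r)%R & box x r `<=` U.

(** The sigma-algebra is generated by the coordinates; an open set belongs to it as a countable
    union of rational boxes. *)
Lemma measurable_box_open (U : set E) : box_open U -> measurable U.
Proof.
move=> Uo.
pose F (z : 'rV[rat]_d * nat) : set E :=
  if `[< box (map_mx ratr z.1) z.2.+1%:R^-1 `<=` U >]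
  then box (map_mx ratr z.1) z.2.+1%:R^-1 else set0.
rewrite (_ : U = \bigcup_z F z); last first.
  apply/seteqP; split => [x /Uo[r r0 xU]|x [z _]]; last first.
    by rewrite /F; case: asboolP => // + zx; exact.
  have [q [k [qx qU]]] := rational_box x r0; exists (q, k) => //.
  by rewrite /F; case: asboolP => //= nU; case: nU; exact: subset_trans qU xU.
apply: countable_bigcupT_measurable => // z; rewrite /F; case: asboolP => // _.
exact: measurable_box.
Qed.

(** Meant for infima of continuous functions, such as the potentials below: their strict sublevel
    sets are open. *)
Lemma usc_measurable (f : E -> \bar R) :
  (forall (x : E) (a : R), f x < a%:E ->
     exists2 r, (0 < r)%R & forall y, box x r y -> f y < a%:E) ->
  measurable_fun [set: E] f.
Proof.
move=> fo; apply: (measurability _ (ErealGenInftyO.measurableE R)) => _ /= -[_ [a ->] <-].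
rewrite setTI; apply: measurable_box_open => x /=.
rewrite in_itv/= => /fo[r r0 h]; exists r => // y /h /= fy.
Qed.

Definition msupport (gamma : probability T R) : set T :=
  [set p | forall r, (0 < r)%R -> 0 < gamma (box p.1 r `*` box p.2 r)].

(** A point off the support lies in a product of rational boxes of mass 0, and there are countably
    many of these. *)
Lemma ae_support (gamma : probability T R) : {ae gamma, forall p, msupport gamma p}.
Proof.
pose Q := (('rV[rat]_d * nat) * ('rV[rat]_d * nat))%type.
pose B (z : Q) : set T := box (map_mx ratr z.1.1) z.1.2.+1%:R^-1 `*`
  box (map_mx ratr z.2.1) z.2.2.+1%:R^-1.
pose F (n : nat) : set T := if unpickle n is Some z then
  (if gamma (B z) == 0 then B z else set0) else set0.
have mB z : measurable (B z) by apply: measurableX; exact: measurable_box.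
have nF n : gamma.-negligible (F n).
  rewrite /F; case: unpickle => [z|]; last exact: negligible_set0.
  case: eqP => z0; last exact: negligible_set0.
  by exists (B z); split; [exact: mB|exact: z0|].
apply: negligibleS (negligible_bigcup nF) => p /= /existsNP[r /not_implyP[r0]].
move=> /negP; rewrite -leNgt => gp.
have [q1 [k1 [q1p q1r]]] := rational_box p.1 r0.
have [q2 [k2 [q2p q2r]]] := rational_box p.2 r0.
pose z : Q := ((q1, k1), (q2, k2)).
exists (pickle z) => //; rewrite /F pickleK.
rewrite (_ : gamma (B z) == 0 = true); first by split.
apply/eqP/eqP; rewrite eq_le measure_ge0 andbT; apply: le_trans gp.
apply: le_measure; rewrite ?inE; [exact: mB| |].
  by apply: measurableX; exact: measurable_box.
by move=> w [w1 w2]; split; [exact: q1r|exact: q2r].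
Qed.

End boxes.

(** * Cyclical monotonicity of the support of an optimal plan *)

Section cyclical_monotonicity.
Context {R : realType} {d : nat}.
Local Notation E := 'rV[R]_d.
Local Notation T := (E * E)%type.
Local Notation c := (@quadratic_cost R d).

Lemma quadratic_cost_continuous (x y : E) (eta : R) : (0 < eta)%R ->
  exists2 r, (0 < r)%R & forall x' y', box x r x' -> box y r y' ->
    (`|c x' y' - c x y| <= eta)%R.
Proof.
move=> eta0.
(* A coordinate difference [a - b] that moves by [e] changes its cost by [e * ((a - b) + e / 2)];
   with [|e| <= 2 * r] and [r <= 1], this is at most [r] times the summand. *)
pose B : R := (\sum_(i < d) (2 * `|x ord0 i - y ord0 i| + 2))%R.
have B0 : (0 <= B)%R by apply: sumr_ge0 => i _; rewrite addr_ge0 ?mulr_ge0.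
pose r : R := Num.min 1%R (eta / (B + 1))%R.
have r0 : (0 < r)%R by rewrite lt_min ltr01 divr_gt0// ltr_wpDl.
have r1 : (r <= 1)%R by rewrite ge_min lexx.
exists r => // x' y' hx hy.
rewrite !quadratic_costE -mulrBr -sumrB mulr_sumr.
apply: (@le_trans _ _ (r * B)%R); last first.
  apply: (@le_trans _ _ (eta / (B + 1) * B)%R).
    by rewrite ler_wpM2r// ge_min lexx orbT.
  by rewrite mulrAC ler_pdivrMr ?ltr_wpDl// ler_pM2l// lerDl.
apply: le_trans (ler_norm_sum _ _ _) _; rewrite /B mulr_sumr; apply: ler_sum => i _.
have := hx i; have := hy i.
move: (x ord0 i) (y ord0 i) (x' ord0 i) (y' ord0 i) => a b a' b' hb ha.
set e := ((a' - b') - (a - b))%R.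
have he : (`|e| <= 2 * r)%R.
  rewrite /e (_ : _ - _ = (a' - a) - (b' - b))%R; last by ring.
  by apply: le_trans (ler_normB _ _) _; lra.
rewrite (_ : 2^-1 * _ = e * ((a - b) + e / 2))%R; last by rewrite /e; field.
rewrite normrM; apply: (@le_trans _ _ (2 * r * (`|a - b| + 1))%R); last by lra.
apply: ler_pM => //.
apply: le_trans (ler_normD _ _) _; rewrite lerD2l normrM (@ger0_norm _ 2^-1%R)//.
lra.
Qed.

Lemma common_radius (I : finType) (P : I -> R -> Prop) :
  (forall i r s, (r <= s)%R -> P i s -> P i r) ->
  (forall i, exists2 r, (0 < r)%R & P i r) ->
  exists2 r, (0 < r)%R & forall i, P i r.
Proof.
move=> Pmono hP.
have hP' i : exists r, (0 < r)%R /\ P i r by have [r r0 Pr] := hP i; exists r.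
have [r rP] := fin_all_exists hP'.
exists (\big[Num.min/1%R]_i r i).
  by apply/bigmin_gtP; split => // i _; have [] := rP i.
by move=> i; apply: Pmono (rP i).2; exact: bigmin_le.
Qed.

Lemma integral_scaled_indic (mu : probability T R) (B : set T) (a : R) :
  measurable B -> (0 <= a)%R -> \int[mu]_p (a * \1_B p)%:E = a%:E * mu B.
Proof.
move=> mB a0; under eq_integral do rewrite EFinM.
rewrite ge0_integralZl//; last by apply/measurable_EFinP; exact: measurable_indic.
by rewrite integral_indic// setIT.
Qed.

(** Applied to the cost at a point of the support lowered by [eta], a level that may be negative. *)
Lemma indic_integral_ge (mu : probability T R) (B : set T) (f : T -> R) (a : R) :
  measurable B -> measurable_fun [set: T] f -> (forall p, 0 <= f p)%R ->
  (forall p, B p -> a <= f p)%R ->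
  a%:E * mu B <= \int[mu]_p (f p * \1_B p)%:E.
Proof.
move=> mB mf f0 af.
have m1 : measurable_fun [set: T] (\1_B : T -> R) by exact: measurable_indic.
have [a0|a0] := leP 0%R a; last first.
  apply: (@le_trans _ _ 0); last by apply: integral_ge0 => p _; rewrite lee_fin mulr_ge0.
  by rewrite mule_le0_ge0// lee_fin ltW.
rewrite -[B in leLHS]setIT -(integral_indic mu measurableT mB) -ge0_integralZl//.
- apply: ge0_le_integral => //.
  + by move=> p _; rewrite mule_ge0// lee_fin.
  + by apply: emeasurable_funM => //; apply/measurable_EFinP.
  + by apply/measurable_EFinP; exact: measurable_funM.
  + move=> p _; rewrite -EFinM lee_fin indicE.
    have [/set_mem Bp|] := boolP (p \in B); last by rewrite !mulr0.
    by rewrite !mulr1 af.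
- by apply/measurable_EFinP.
Qed.

Variables (mu0 mu1 : probability E R) (gamma : probability T R) (c0 : R).
Hypotheses (cg : couplings mu0 mu1 gamma) (hc0 : transport_cost c gamma = c0%:E).
Hypothesis opt : forall gamma', couplings mu0 mu1 gamma' ->
  c0%:E <= transport_cost c gamma'.

(* If a cyclic exchange of partners along finitely many points of the support
   were profitable, performing it on a small amount of mass around these points
   would beat [gamma]. *)
Lemma cyclically_monotone (n : nat) (p : 'I_n -> T) : (forall i, msupport gamma (p i)) ->
  (0 <= \sum_(i < n) (c (p (ordS i)).1 (p i).2 - c (p i).1 (p i).2))%R.
Proof.
move=> sp; rewrite leNgt; apply/negP => S0.
have ngt0 : (0 < n)%N.
  case: (posnP n) => // n00; move: S0; rewrite big1 ?ltxx// => i.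
  by have := ltn_ord i; rewrite [X in (_ < X)%N]n00.
set S := (\sum_(i < n) _)%R in S0.
have n0 : (0 < n%:R :> R)%R by rewrite ltr0n.
(* The [2 n] errors of size [eta] add up to half of [- S], so the exchange keeps a gain of [- S / 2]
   per unit of mass. *)
pose eta : R := (- S / (4 * n%:R))%R.
have eta0 : (0 < eta)%R by rewrite divr_gt0 ?oppr_gt0 ?mulr_gt0.
have [r r0 hr] : exists2 r, (0 < r)%R & forall ij : 'I_n * 'I_n, forall x' y',
    box (p ij.1).1 r x' -> box (p ij.2).2 r y' ->
    (`|c x' y' - c (p ij.1).1 (p ij.2).2| <= eta)%R.
  apply: common_radius => [ij r s rs h x' y' hx hy|ij].
    by apply: h; [exact: box_sub rs _ hx|exact: box_sub rs _ hy].
  exact: quadratic_cost_continuous.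
pose B (i : 'I_n) : set T := box (p i).1 r `*` box (p i).2 r.
have mB i : measurable (B i) by apply: measurableX; exact: measurable_box.
pose m (i : 'I_n) : R := fine (gamma (B i)).
have mE i : gamma (B i) = (m i)%:E by rewrite fineK// fin_num_measure.
have m0 i : (0 < m i)%R by rewrite -lte_fin -mE; exact: sp.
(* Mass [lam] is taken from each box, with density [lam / m i]; this value of [lam] keeps the total
   density [W] at most 1 even where boxes overlap. *)
pose lam : R := ((\sum_i (m i)^-1)^-1)%R.
have sm0 : (0 < \sum_i (m i)^-1)%R.
  rewrite (bigD1 (Ordinal ngt0))//= ltr_pwDl ?invr_gt0// sumr_ge0// => i _.
  by rewrite invr_ge0 ltW.
have lam0 : (0 < lam)%R by rewrite invr_gt0.
pose W (q : T) : R := (\sum_i lam / m i * \1_(B i) q)%R.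
pose g (q : T) : R := (1 - W q)%R.
(* The mass is put back by pairing, independently, first components from the next box in the cycle
   with second components from the current one. *)
pose G (z : T * T) : R :=
  (\sum_i lam / (m (ordS i) * m i) * (\1_(B (ordS i)) z.1 * \1_(B i) z.2))%R.
have m1 i : measurable_fun [set: T] (\1_(B i) : T -> R) by exact: measurable_indic.
have mW : measurable_fun [set: T] W.
  by apply: measurable_sum => i; exact: measurable_funM.
have mg : measurable_fun [set: T] g by exact: measurable_funB.
have mind i j : measurable_fun [set: T * T] (fun z : T * T => \1_(B i) z.1 * \1_(B j) z.2 : R)%R.
  apply: measurable_funM.
    exact: measurableT_comp (m1 i) measurable_fst.
  exact: measurableT_comp (m1 j) measurable_snd.
have mG : measurable_fun [set: T * T] G.
  by apply: measurable_sum => i; exact: measurable_funM.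
have W1 q : (W q <= 1)%R.
  rewrite /W -(mulVf (lt0r_neq0 sm0)) -/lam mulr_sumr; apply: ler_sum => i _.
  rewrite indicE ler_piMr ?divr_ge0 ?(ltW lam0) ?(ltW (m0 i))//.
  by case: (_ \in _); rewrite ?lexx ?ler01.
have g0 q : (0 <= g q)%R by rewrite subr_ge0.
have lmm0 i : (0 <= lam / (m (ordS i) * m i))%R by rewrite divr_ge0 ?mulr_ge0 ?(ltW lam0) ?(ltW (m0 _)).
have G0 z : (0 <= G z)%R by apply: sumr_ge0 => i _; rewrite mulr_ge0.
have hfst q : (g q)%:E + \int[gamma]_q' (G (q, q'))%:E = 1.
  suff -> : \int[gamma]_q' (G (q, q'))%:E = (W q)%:E by rewrite -EFinD subrK.
  under eq_integral do rewrite /G -sumEFin/=.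
  rewrite ge0_integral_sum//; last 2 first.
  - move=> i; apply/measurable_EFinP; apply: measurable_funM => //.
    exact: measurable_funM.
  - by move=> i q' _; rewrite lee_fin mulr_ge0.
  (* The cyclic successor permutes the boxes, so the first components put back are those taken
     away. *)
  have -> : W q = (\sum_i lam / m (ordS i) * \1_(B (ordS i)) q)%R.
    by rewrite /W (reindex_inj (@ordS_inj n)).
  rewrite -sumEFin; apply: eq_bigr => i _.
  under eq_integral do rewrite mulrA.
  rewrite integral_scaled_indic; [|exact: mB|by rewrite mulr_ge0]; rewrite mE.
  by rewrite -EFinM; congr EFin; field; rewrite !gt_eqF.
have hsnd q : (g q)%:E + \int[gamma]_q' (G (q', q))%:E = 1.
  suff -> : \int[gamma]_q' (G (q', q))%:E = (W q)%:E by rewrite -EFinD subrK.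
  under eq_integral do rewrite /G -sumEFin/=.
  rewrite ge0_integral_sum//; last 2 first.
  - move=> i; apply/measurable_EFinP; apply: measurable_funM => //.
    exact: measurable_funM.
  - by move=> i q' _; rewrite lee_fin mulr_ge0.
  rewrite /W -sumEFin; apply: eq_bigr => i _.
  under eq_integral do rewrite (mulrC (\1_(B (ordS i)) _)) mulrA.
  rewrite integral_scaled_indic; [|exact: mB|by rewrite mulr_ge0]; rewrite mE.
  by rewrite -EFinM; congr EFin; field; rewrite !gt_eqF.
have [gamma' [cg' gE]] := resampling cg mg mG g0 G0 hfst hsnd.
have mc : measurable_fun [set: T] (fun q : T => c q.1 q.2) by exact: measurable_quadratic_cost.
have mcE : measurable_fun [set: T] (fun q : T => (c q.1 q.2)%:E) by apply/measurable_EFinP.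
have c_ge0 q : 0 <= (c q.1 q.2)%:E by rewrite lee_fin quadratic_cost_ge0.
have := opt cg'; rewrite /transport_cost gE//.
pose A := \int[gamma]_q ((c q.1 q.2)%:E * (g q)%:E).
have W0 q : (0 <= W q)%R by apply: sumr_ge0 => i _; rewrite mulr_ge0// divr_ge0 ?(ltW lam0) ?(ltW (m0 _)).
have split_c0 : c0%:E = A + \int[gamma]_q (c q.1 q.2 * W q)%:E.
  rewrite -hc0 /transport_cost -ge0_integralD//.
  - by apply: eq_integral => q _; rewrite -EFinM -EFinD -mulrDr subrK mulr1.
  - by move=> q _; rewrite mule_ge0// lee_fin.
  - by apply: emeasurable_funM => //; apply/measurable_EFinP.
  - by move=> q _; rewrite lee_fin mulr_ge0 ?quadratic_cost_ge0.
  - by apply/measurable_EFinP; exact: measurable_funM.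
have lower : (\sum_i lam * (c (p i).1 (p i).2 - eta))%:E <=
    \int[gamma]_q (c q.1 q.2 * W q)%:E.
  under eq_integral do rewrite /W mulr_sumr -sumEFin.
  rewrite ge0_integral_sum//; last 2 first.
  - by move=> i; apply/measurable_EFinP; do 2 apply: measurable_funM => //.
  - move=> i q _; rewrite lee_fin mulr_ge0 ?quadratic_cost_ge0// mulr_ge0//.
    by rewrite divr_ge0// ltW.
  rewrite -sumEFin; apply: lee_sum => i _.
  under eq_integral do rewrite mulrCA EFinM.
  rewrite ge0_integralZl//; last 3 first.
  - by apply/measurable_EFinP; apply: measurable_funM.
  - by move=> q _; rewrite lee_fin mulr_ge0 ?quadratic_cost_ge0.
  - by rewrite lee_fin divr_ge0 ?ltW.
  rewrite -lee_pdivrMl ?divr_gt0//.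
  apply: le_trans (indic_integral_ge gamma (mB i) mc (fun q => quadratic_cost_ge0 q.1 q.2)
    (a := (c (p i).1 (p i).2 - eta)%R) _).
    rewrite mE -!EFinM lee_fin le_eqVlt; apply/orP; left; apply/eqP.
    by field; rewrite !gt_eqF.
  move=> q [q1 q2]; have := hr (i, i) _ _ q1 q2; rewrite ler_norml => /andP[]/=; lra.
have upper : \int[gamma]_q \int[gamma]_q' ((c q.1 q'.2)%:E * (G (q, q'))%:E) <=
    (\sum_i lam * (c (p (ordS i)).1 (p i).2 + eta))%:E.
  pose K i : R := (lam / (m (ordS i) * m i) * (c (p (ordS i)).1 (p i).2 + eta))%R.
  have K0 i : (0 <= K i)%R by rewrite mulr_ge0// addr_ge0 ?quadratic_cost_ge0 ?ltW.
  pose H q q' : R := (\sum_i K i * (\1_(B (ordS i)) q * \1_(B i) q'))%R.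
  have HE q : \int[gamma]_q' (H q q')%:E = (\sum_i K i * m i * \1_(B (ordS i)) q)%:E.
    under eq_integral do rewrite /H -sumEFin/=.
    rewrite ge0_integral_sum//; last 2 first.
    - by move=> i; apply/measurable_EFinP; do 2 apply: measurable_funM => //.
    - by move=> i q' _; rewrite lee_fin mulr_ge0// mulr_ge0.
    rewrite -sumEFin; apply: eq_bigr => i _.
    under eq_integral do rewrite mulrA.
    rewrite integral_scaled_indic; [|exact: mB|by rewrite mulr_ge0]; rewrite mE.
    by rewrite -EFinM mulrAC.
  have HT : \int[gamma]_q (\sum_i K i * m i * \1_(B (ordS i)) q)%:E =
      (\sum_i lam * (c (p (ordS i)).1 (p i).2 + eta))%:E.
    under eq_integral do rewrite -sumEFin/=.
    rewrite ge0_integral_sum//; last 2 first.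
    - by move=> i; apply/measurable_EFinP; do 2 apply: measurable_funM => //.
    - by move=> i q' _; rewrite lee_fin mulr_ge0// mulr_ge0// ltW.
    rewrite -sumEFin; apply: eq_bigr => i _.
    rewrite integral_scaled_indic; [|exact: mB|by rewrite mulr_ge0// ltW]; rewrite mE.
    by rewrite -EFinM; congr EFin; rewrite /K; field; rewrite !gt_eqF.
  rewrite -HT; apply: ge0_le_integral => //.
  - by move=> q _; apply: integral_ge0 => q' _; rewrite mule_ge0// lee_fin ?quadratic_cost_ge0.
  - have mF : measurable_fun [set: T * T] (fun z : T * T => (c z.1.1 z.2.2)%:E * (G z)%:E).
      apply: emeasurable_funM; last by apply/measurable_EFinP.
      apply: (measurableT_comp mcE (g := fun z : T * T => (z.1.1, z.2.2))).
      apply: measurable_fun_pair; first exact: measurableT_comp measurable_fst measurable_fst.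
      exact: measurableT_comp measurable_snd measurable_snd.
    have := @measurable_fun_fubini_tonelli_F _ _ _ _ _ gamma _ mF.
    by apply => z; rewrite mule_ge0// lee_fin ?quadratic_cost_ge0.
  - by apply/measurable_EFinP; apply: measurable_sum => i; exact: measurable_funM.
  move=> q _; rewrite -HE; apply: ge0_le_integral => //.
  - by move=> q' _; rewrite mule_ge0// lee_fin ?quadratic_cost_ge0.
  - apply: emeasurable_funM.
      apply: (measurableT_comp mcE (g := fun q' : T => (q.1, q'.2))).
      by apply: measurable_fun_pair => //; exact: measurable_snd.
    by apply/measurable_EFinP; exact: (measurable_fun_pair2 q mG).
  - apply/measurable_EFinP; apply: measurable_sum => i.
    by do 2 apply: measurable_funM => //.
  move=> q' _; rewrite -EFinM lee_fin /G /H mulr_sumr; apply: ler_sum => i _ /=.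
  rewrite mulrA [(c _ _ * _)%R]mulrC /K !indicE.
  have [/set_mem Bq|] := boolP (q \in B (ordS i)); last by rewrite !mul0r !mulr0.
  have [/set_mem Bq'|] := boolP (q' \in B i); last by rewrite !mulr0.
  rewrite !mulr1 ler_wpM2l//.
  have := hr (ordS i, i) _ _ Bq.1 Bq'.2; rewrite ler_norml => /andP[]/=; lra.
have A0 : 0 <= A by apply: integral_ge0 => q _; rewrite mule_ge0// lee_fin.
have Afin : A \is a fin_num.
  rewrite ge0_fin_numE//; apply: (@le_lt_trans _ _ c0%:E); last exact: ltry.
  by rewrite split_c0 leeDl// integral_ge0// => q _; rewrite lee_fin mulr_ge0 ?quadratic_cost_ge0.
(* The cost [A] of the untouched mass is finite and cancels, leaving
   [0 <= lam * (S + 2 * eta * n)]. *)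
move=> h; have := le_trans h (leeD2l A upper).
have := leeD2l A lower; rewrite -split_c0.
rewrite -(fineK Afin) -!EFinD !lee_fin -!mulr_sumr.
have -> : (\sum_i (c (p i).1 (p i).2 - eta) =
    \sum_i c (p i).1 (p i).2 - eta * n%:R)%R.
  by rewrite sumrB sumr_const card_ord mulr_natr.
have -> : (\sum_i (c (p (ordS i)).1 (p i).2 + eta) =
    \sum_i c (p (ordS i)).1 (p i).2 + eta * n%:R)%R.
  by rewrite big_split sumr_const card_ord mulr_natr.
move=> h1 h2.
have : (0 <= lam * (S + 2 * (eta * n%:R)))%R.
  by rewrite /S sumrB; lra.
rewrite pmulr_rge0// /eta.
rewrite (_ : S + _ = S / 2)%R; last by field; rewrite gt_eqF.
by rewrite leNgt pmulr_llt0 ?S0// invr_gt0.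
Qed.

End cyclical_monotonicity.

(** * Truncation of potentials *)

Section clamp.
Context {R : realType}.

(* Truncating both potentials at the levels [-n] and [n] preserves admissibility
   because the cost is nonnegative. *)
Definition clamp (n : nat) (e : \bar R) : R := fine (maxe (- n%:R)%:E (mine e n%:R%:E)).

Lemma clamp_fin (n : nat) (r : R) : clamp n r%:E = Num.max (- n%:R)%R (Num.min r n%:R).
Proof. by rewrite /clamp -EFin_min -EFin_max. Qed.

Lemma clampNy (n : nat) : clamp n -oo = (- n%:R)%R.
Proof. by rewrite /clamp minNye maxeNy. Qed.

Lemma clamp_bounds (n : nat) (e : \bar R) : (- n%:R <= clamp n e <= n%:R)%R.
Proof.
have n0 : (0 <= n%:R :> R)%R by [].
have Nn : (- n%:R <= n%:R :> R)%R by lra.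
rewrite /clamp; case: e => [r| |].
- by rewrite -EFin_min -EFin_max/= le_max lexx ge_max Nn ge_min lexx orbT.
- by rewrite minye -EFin_max/= le_max lexx ge_max Nn lexx.
- by rewrite minNye maxeNy/= lexx.
Qed.

Lemma clamp_id (n : nat) (r : R) : (`|r| <= n%:R)%R -> clamp n r%:E = r.
Proof.
rewrite ler_norml clamp_fin => /andP[r1 r2].
by rewrite min_l// max_r.
Qed.

(** If one of the terms is raised to [- n], the sum is at most [- n + n = 0]; otherwise truncation
    only lowers it. *)
Lemma clamp_sum_le (n : nat) (a b : \bar R) (c : R) : (0 <= c)%R ->
  a != +oo -> b != +oo -> a + b <= c%:E -> (clamp n a + clamp n b <= c)%R.
Proof.
move=> c0; have n0 : (0 <= n%:R :> R)%R by [].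
have := clamp_bounds n a; have := clamp_bounds n b.
case: a => [r| |]//; case: b => [s| |]//; rewrite ?clampNy; last 3 first.
- by move=> /andP[? ?] /andP[? ?] _ _ _; lra.
- by move=> /andP[? ?] /andP[? ?] _ _ _; lra.
- by move=> /andP[? ?] /andP[? ?] _ _ _; lra.
rewrite -EFinD lee_fin !clamp_fin => _ _ _ _.
move: (n%:R)%R n0 => N N0.
by case: (leP r N); case: (leP s N); case: (leP (- N)%R r); case: (leP (- N)%R s);
  case: (leP (- N)%R N) => *; lra.
Qed.

(** Together with the upper bound, this makes the cost a dominating function on the support. *)
Lemma clamp_sum_ge0 (n : nat) (r s : R) : (0 <= r + s)%R ->
  (0 <= clamp n r%:E + clamp n s%:E)%R.
Proof.
have n0 : (0 <= n%:R :> R)%R by [].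
rewrite !clamp_fin.
move: (n%:R)%R n0 => N N0.
by case: (leP r N); case: (leP s N); case: (leP (- N)%R r); case: (leP (- N)%R s);
  case: (leP (- N)%R N) => *; lra.
Qed.

Lemma measurable_clamp d (T : measurableType d) (n : nat) (f : T -> \bar R) :
  measurable_fun [set: T] f -> measurable_fun [set: T] (fun x => clamp n (f x)).
Proof.
move=> mf; rewrite /clamp.
apply: (measurableT_comp (f := fine)) => //.
by apply: measurable_maxe => //; exact: measurable_mine.
Qed.

End clamp.

(** * Rockafellar potentials and approximate duality *)

Section duality.
Context {R : realType} {d : nat}.
Local Notation E := 'rV[R]_d.
Local Notation T := (E * E)%type.
Local Notation c := (@quadratic_cost R d).
Variables (mu0 mu1 : probability E R) (gamma : probability T R) (c0 : R).
Hypotheses (cg : couplings mu0 mu1 gamma) (hc0 : transport_cost c gamma = c0%:E).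
Hypothesis opt : forall gamma', couplings mu0 mu1 gamma' ->
  c0%:E <= transport_cost c gamma'.

(** The change of cost when each second component of the chain is matched with the next first
    component, and the last one with [x]. *)
Let chain (f : nat -> T) (n : nat) (x : E) : R :=
  (\sum_(i < n) (c (f i.+1).1 (f i).2 - c (f i).1 (f i).2) +
    (c x (f n).2 - c (f n).1 (f n).2))%R.

Let chains (p0 : T) (x : E) : set (\bar R) :=
  [set (chain z.1 z.2 x)%:E | z in
    [set z : (nat -> T) * nat | z.1 0%N = p0 /\ forall i, msupport gamma (z.1 i)]].

(* Rockafellar's potential, attached to the cyclically monotone support. *)
Let rock (p0 : T) (x : E) : \bar R := ereal_inf (chains p0 x).
Let rock_conj (p0 : T) (y : E) : \bar R :=
  ereal_inf [set (c x y)%:E - rock p0 x | x in [set: E]].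

Variable p0 : T.
Hypothesis sp0 : msupport gamma p0.
Let phi := rock p0.
Let psi := rock_conj p0.

Let phi_lty x : phi x < +oo.
Proof.
apply: (@le_lt_trans _ _ (chain (fun=> p0) 0 x)%:E); last exact: ltry.
by apply: ereal_inf_lbound; exists ((fun=> p0), 0%N).
Qed.

(** A chain that ends at its starting point is a cycle, so cyclical monotonicity applies to it. *)
Let phi_ge0 : 0 <= phi p0.1.
Proof.
apply: le_ereal_inf_tmp => _ [[f n] [/= f0 sf] <-]; rewrite lee_fin.
have := cyclically_monotone cg hc0 opt (fun i : 'I_n.+1 => sf i).
rewrite big_ord_recr/= modnn f0 /chain; congr (0 <= _ + _)%R.
by apply: eq_bigr => i _; rewrite modn_small// ltnS.
Qed.

(** Append [p] to a chain that ends at [p.1]. *)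
Let phi_step p x : msupport gamma p -> phi x <= phi p.1 + (c x p.2 - c p.1 p.2)%:E.
Proof.
move=> sp; rewrite -leeBlDr//; apply: le_ereal_inf_tmp => _ [[f n] [/= f0 sf] <-].
rewrite EFinN leeBlDr// -EFinD.
pose f' i := if (i <= n)%N then f i else p.
apply: ereal_inf_lbound; exists (f', n.+1).
  by split => [//|i]; rewrite /= /f'; case: ifP.
congr EFin; rewrite /chain big_ord_recr/= /f' leqnn ltnn; congr (_ + _ + _)%R.
by apply: eq_bigr => i _; rewrite (ltn_ord i) ltnW.
Qed.

(** A value [-oo] at [p.1] would propagate to [p0.1] through [phi_step], against [phi_ge0]. *)
Let phi_fin p : msupport gamma p -> phi p.1 \is a fin_num.
Proof.
move=> sp; rewrite fin_numE; apply/andP; split; last by rewrite lt_eqF.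
apply/eqP => pNy; have := phi_step p0.1 sp; rewrite pNy addNye leeNy_eq.
by move/eqP => h; have := phi_ge0; rewrite h.
Qed.

Let psi_lty y : psi y < +oo.
Proof.
have /fineK p0E := phi_fin sp0.
apply: (@le_lt_trans _ _ ((c p0.1 y)%:E - phi p0.1)).
  by apply: ereal_inf_lbound; exists p0.1.
by rewrite -p0E -EFinB ltry.
Qed.

Let phi_psi_le x y : phi x + psi y <= (c x y)%:E.
Proof.
have := phi_lty x; case px : (phi x) => [r| |]// _; last first.
  by rewrite addNye leNye.
have : psi y <= (c x y)%:E - phi x by apply: ereal_inf_lbound; exists x.
by rewrite px leeBrDl.
Qed.

(** By [phi_step], the infimum that defines [psi] at [p.2] is attained at [p.1]. *)
Let phi_psi_eq p : msupport gamma p ->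
  exists r s : R, [/\ phi p.1 = r%:E, psi p.2 = s%:E & (r + s = c p.1 p.2)%R].
Proof.
move=> sp; have /fineK pE := phi_fin sp.
exists (fine (phi p.1)), (c p.1 p.2 - fine (phi p.1))%R; split => //; last first.
  by rewrite subrKC.
apply/eqP; rewrite eq_le; apply/andP; split.
  by apply: ereal_inf_lbound; exists p.1 => //; rewrite EFinB pE.
apply: le_ereal_inf_tmp => _ [x _ <-].
rewrite -/(phi x).
have := phi_step x sp; have := phi_lty x; rewrite -pE.
case: (phi x) => [r| |]// _; last by rewrite leey.
by rewrite -EFinD -EFinB !lee_fin; lra.
Qed.

Let measurable_phi : measurable_fun [set: E] phi.
Proof.
apply: usc_measurable => x a /ereal_inf_lt[_ [[f n] fP <-]]; rewrite lte_fin => ca.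
pose eta := ((a - chain f n x) / 2)%R.
have eta0 : (0 < eta)%R by rewrite divr_gt0// subr_gt0.
have [r r0 hr] := quadratic_cost_continuous x (f n).2 eta0.
exists r => // x' xx'; apply: (@le_lt_trans _ _ (chain f n x')%:E).
  by apply: ereal_inf_lbound; exists (f, n).
rewrite lte_fin; have := hr _ _ xx' (box_center (f n).2 r0).
by move: ca; rewrite /eta /chain ler_norml => ca /andP[_]; lra.
Qed.

Let measurable_psi : measurable_fun [set: E] psi.
Proof.
apply: usc_measurable => y a /ereal_inf_lt[_ [x _ <-]].
have := phi_lty x; rewrite -/(phi x); case px : (phi x) => [s| |]// _.
rewrite -EFinB lte_fin => ca.
pose eta := ((a - (c x y - s)) / 2)%R.
have eta0 : (0 < eta)%R by rewrite divr_gt0// subr_gt0.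
have [r r0 hr] := quadratic_cost_continuous x y eta0.
exists r => // y' yy'; apply: (@le_lt_trans _ _ ((c x y')%:E - phi x)).
  by apply: ereal_inf_lbound; exists x.
rewrite px -EFinB lte_fin; have := hr _ _ (box_center x r0) yy'.
by move: ca; rewrite /eta ler_norml => ca /andP[_]; lra.
Qed.

Let clamp_integrable (mu : probability E R) (f : E -> \bar R) n :
  measurable_fun [set: E] f -> mu.-integrable [set: E] (EFin \o (fun x => clamp n (f x))).
Proof.
move=> mf; apply: measurable_bounded_integrable => //.
- exact: le_lt_trans (@probability_le1 _ _ _ mu _ measurableT) (ltry _).
- exact: measurable_clamp.
- exists n%:R; split => // M nM x _ /=.
  by rewrite (le_trans _ (ltW nM))// ler_norml clamp_bounds.
Qed.

Let clamp_admissible n :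
  dual_admissible c mu0 mu1 (fun x => clamp n (phi x)) (fun y => clamp n (psi y)).
Proof.
split; [exact: clamp_integrable|exact: clamp_integrable|] => x y.
by apply: clamp_sum_le => //; rewrite ?quadratic_cost_ge0// lt_eqF.
Qed.

Let clamp_dual_value n :
  dual_value mu0 mu1 (fun x => clamp n (phi x)) (fun y => clamp n (psi y)) =
  \int[gamma]_p (clamp n (phi p.1) + clamp n (psi p.2))%:E.
Proof.
have [i0 i1 _] := clamp_admissible n.
rewrite /dual_value -(coupling_fst cg i0) -(coupling_snd cg i1) -integralD//.
- exact: (coupling_fst_integrable cg i0).
- exact: (coupling_snd_integrable cg i1).
Qed.

(** At a point of the support the truncated sum lies between 0 and the cost, and equals the cost
    once [n] exceeds both potentials. Dominated convergence thus spares any proof that [phi] and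
    [psi] themselves are integrable. *)
Let clamp_cvg : (\int[gamma]_p (clamp n (phi p.1) + clamp n (psi p.2))%:E) @[n --> \oo]
  --> c0%:E.
Proof.
have mc : measurable_fun [set: T] (fun p : T => (c p.1 p.2)%:E).
  by apply/measurable_EFinP; exact: measurable_quadratic_cost.
have [] := @dominated_convergence _ _ _ gamma setT measurableT
  (fun n p => (clamp n (phi p.1) + clamp n (psi p.2))%:E)
  (fun p => (c p.1 p.2)%:E) (fun p => (c p.1 p.2)%:E) _ mc _ _ _.
- move=> n; apply/measurable_EFinP; apply: measurable_funD.
    by apply: measurable_clamp; exact: measurableT_comp measurable_phi measurable_fst.
  by apply: measurable_clamp; exact: measurableT_comp measurable_psi measurable_snd.
- apply: filterS (ae_support gamma) => p sp _.
  have [r [s [-> -> rs]]] := phi_psi_eq sp.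
  apply: cvg_near_cst.
  exists (Num.truncn (`|r| + `|s|)).+1 => // n /= nk.
  have rsn : (`|r| + `|s| <= n%:R)%R.
    by apply: ltW; apply: lt_le_trans (truncnS_gt _) _; rewrite ler_nat.
  have := normr_ge0 r; have := normr_ge0 s => r1 s1.
  by rewrite !clamp_id ?rs//; lra.
- apply/integrableP; split => //.
  under eq_integral do rewrite gee0_abs ?lee_fin ?quadratic_cost_ge0//.
  by rewrite -/(transport_cost c gamma) hc0 ltry.
- apply: filterS (ae_support gamma) => p sp n _.
  have [r [s [pr ps rs]]] := phi_psi_eq sp.
  have rs0 : (0 <= r + s)%R by rewrite rs quadratic_cost_ge0.
  rewrite pr ps gee0_abs ?lee_fin ?clamp_sum_ge0//.
  apply: clamp_sum_le; rewrite ?quadratic_cost_ge0//.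
  by rewrite -EFinD rs.
by move=> _ _; rewrite -hc0; exact.
Qed.

Lemma approximate_duality_support (eta : R) : (0 < eta)%R ->
  exists phi psi, dual_admissible c mu0 mu1 phi psi /\
    (c0 - eta)%:E <= dual_value mu0 mu1 phi psi.
Proof.
move=> eta0.
have [n _ hn] : \forall n \near \oo, (c0 - eta)%:E <
    \int[gamma]_p (clamp n (phi p.1) + clamp n (psi p.2))%:E.
  have lt0 : (c0 - eta)%:E < c0%:E by rewrite lte_fin gtrBl.
  exact: (clamp_cvg (open_ereal_gt' lt0)).
exists (fun x => clamp n (phi x)), (fun y => clamp n (psi y)).
by split; [exact: clamp_admissible|rewrite clamp_dual_value ltW// hn/=].
Qed.

End duality.

(** * Rates *)

Section suboptimality.
Context {R : realType} {d : nat}.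
Local Notation E := 'rV[R]_d.
Local Notation T := (E * E)%type.
Local Notation c := (@quadratic_cost R d).

(** Supplies the base point of the chains: a support of full measure is not empty. *)
Lemma approximate_duality (mu0 mu1 : probability E R) (gamma : probability T R) (c0 eta : R) :
  couplings mu0 mu1 gamma -> transport_cost c gamma = c0%:E ->
  (forall gamma', couplings mu0 mu1 gamma' -> c0%:E <= transport_cost c gamma') ->
  (0 < eta)%R ->
  exists phi psi, dual_admissible c mu0 mu1 phi psi /\
    (c0 - eta)%:E <= dual_value mu0 mu1 phi psi.
Proof.
move=> cg hc0 opt eta0.
have [[p sp]|nsp] := pselect (exists p, msupport gamma p).
  exact: (approximate_duality_support cg hc0 opt sp eta0).
have [A [mA A0 sA]] := ae_support gamma.
have AT : A = setT.
  apply/seteqP; split => // p _; apply: sA => sp; apply: nsp; by exists p.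
by have := @probability_setT _ _ _ gamma; rewrite -AT A0 => /esym/eqP; rewrite onee_eq0.
Qed.

Lemma duality_gap_integral (mu0 mu1 : probability E R) (gamma : probability T R)
    (phi psi : E -> R) :
  couplings mu0 mu1 gamma ->
  gamma.-integrable [set: T] (fun p : T => (c p.1 p.2)%:E) ->
  dual_admissible c mu0 mu1 phi psi ->
  gamma.-integrable [set: T] (fun p : T => (duality_gap c phi psi p.1 p.2)%:E) /\
  \int[gamma]_p (duality_gap c phi psi p.1 p.2)%:E =
    transport_cost c gamma - dual_value mu0 mu1 phi psi.
Proof.
move=> cg ic [i0 i1 _].
have g0 := coupling_fst_integrable cg i0; have g1 := coupling_snd_integrable cg i1.
have gE : (fun p : T => (duality_gap c phi psi p.1 p.2)%:E) =
    (fun p : T => (c p.1 p.2)%:E - (phi p.1)%:E - (psi p.2)%:E) by [].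
have icphi := integrableB measurableT ic g0.
rewrite gE; split; first by apply: integrableB => //; exact: icphi.
rewrite integralB// integralB//.
rewrite (coupling_fst cg i0) (coupling_snd cg i1) /dual_value.
have f1 : \int[mu1]_y (psi y)%:E \is a fin_num by exact: integrable_fin_num i1.
by rewrite (fin_num_oppeD _ f1) addeA.
Qed.

(** One inequality holds because the gap is nonnegative under [gamma], the other because maximal
    potentials do at least as well as approximate ones of arbitrarily small defect. *)
Lemma optimal_dual_value (mu0 mu1 : probability E R) (gamma : probability T R) (c0 : R)
    (phi psi : E -> R) :
  couplings mu0 mu1 gamma -> transport_cost c gamma = c0%:E ->
  (forall gamma', couplings mu0 mu1 gamma' -> c0%:E <= transport_cost c gamma') ->
  kantorovich_potentials c mu0 mu1 phi psi ->
  dual_value mu0 mu1 phi psi = c0%:E.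
Proof.
move=> cg hc0 opt [_ adm maxi _ _].
have ic : gamma.-integrable [set: T] (fun p : T => (c p.1 p.2)%:E).
  apply: integrable_of_integral_fin hc0.
  by apply/measurable_EFinP; exact: measurable_quadratic_cost.
have [ig gI] := duality_gap_integral cg ic adm.
have gap0 : 0 <= \int[gamma]_p (duality_gap c phi psi p.1 p.2)%:E.
  by apply: integral_ge0 => p _; rewrite lee_fin duality_gap_ge0//; case: adm.
have dfin : dual_value mu0 mu1 phi psi \is a fin_num.
  by case: adm => i0 i1 _; rewrite fin_numD !integrable_fin_num.
apply/eqP; rewrite eq_le; apply/andP; split.
  by move: gap0; rewrite gI hc0 sube_ge0// dfin.
rewrite -(fineK dfin) lee_fin; apply/ler_addgt0Pl => eta eta0.
have [phi' [psi' [adm' h]]] := approximate_duality cg hc0 opt eta0.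
have := le_trans h (maxi _ _ adm').
by rewrite -(fineK dfin) lee_fin lerBlDl.
Qed.

(** The duality defect is also taken to be [tau], so the gap has mean at most [s + tau <= 2 * tau].
    Keeping [tau] apart from [s] allows [s = 0]. *)
Lemma entropy_coupling_lower (mu0 mu1 : probability E R) (gamma0 gamma : probability T R)
    (c0 s tau K0 K1 : R) :
  couplings mu0 mu1 gamma0 -> transport_cost c gamma0 = c0%:E ->
  (forall gamma', couplings mu0 mu1 gamma' -> c0%:E <= transport_cost c gamma') ->
  \int[mu0]_x (enorm x ^+ 2)%:E <= K0%:E -> \int[mu1]_x (enorm x ^+ 2)%:E <= K1%:E ->
  couplings mu0 mu1 gamma -> transport_cost c gamma = (c0 + s)%:E ->
  (0 < tau)%R -> (s <= tau)%R ->
  (- (d%:R / 2 * ln tau) - @entropy_lower_const R d (K0 + K1))%:E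
    <= entropy (lebesgue_rV2 R d) gamma.
Proof.
move=> cg0 hc0 opt hK0 hK1 cg hc tau0 stau.
have [phi [psi [adm dual]]] := approximate_duality cg0 hc0 opt tau0.
have ic := integrable_quadratic_cost cg hK0 hK1.
have [ig gI] := duality_gap_integral cg ic adm.
have [i0 i1 le_c] := adm.
apply: (@entropy_lower_bound R d phi psi _ _ le_c mu0 mu1 gamma K0 K1 tau) => //.
- by apply/measurable_EFinP; exact: measurable_int i0.
- by apply/measurable_EFinP; exact: measurable_int i1.
rewrite gI hc; apply: (@le_trans _ _ ((c0 + s)%:E - (c0 - tau)%:E)).
  exact: leeB.
by rewrite -EFinB lee_fin; lra.
Qed.

End suboptimality.

(** * Explicit constants and the scalar inequality *)

Section rate_constants.
Context {R : realType} (d : nat) (delta M0 M1 H0 H1 : R).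

(** The first term is the extra cost of the competitor divided by [eps], because [(delta / 2 * n) ^-
    2 / 4 = (delta * n) ^- 2] and [n ^- 2 <= eps]. The [ln 4] comes from [grid_size]. *)
Definition competitor_const : R :=
  (grid_weight_const (d := d) delta (M0 + M1) / delta ^+ 2 + (H0 + H1 + d%:R * ln 4))%R.
Definition rate_const : R :=
  (competitor_const + @entropy_lower_const R d ((1 + M0) + (1 + M1)))%R.
(** Chosen so that [d / 2 * ln rate_lower = - (|rate_const| + 1)]. *)
Definition rate_lower : R := expR (- (2 / d%:R * (`|rate_const| + 1))).
(** From [ln r <= r / d + ln d], the inequality [r <= D + d / 2 * ln r] gives
    [r <= 2 * D + d * ln d]. Adding [rate_lower] secures the order of the two constants. *)
Definition rate_upper : R := (2 * `|rate_const| + d%:R * ln d%:R + rate_lower)%R.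
Definition entropy_const : R :=
  (`|competitor_const| + `|@entropy_lower_const R d ((1 + M0) + (1 + M1))| +
    d%:R / 2 * `|ln rate_upper|)%R.

Hypothesis d_gt0 : (0 < d)%N.

Lemma rate_lower_gt0 : (0 < rate_lower)%R. Proof. exact: expR_gt0. Qed.

Lemma rate_lower_upper : (rate_lower <= rate_upper)%R.
Proof.
rewrite /rate_upper lerDr addr_ge0 ?mulr_ge0// ln_ge0//.
by rewrite ler1n.
Qed.

(** If [s] were below [rate_lower * eps], this value of [tau] would make the right-hand side at most
    [- eps]. Once [s] is known to be positive, [tau = s] gives the upper bound. *)
Lemma rate_bounds (eps s : R) : (0 < eps)%R -> (0 <= s)%R ->
  (forall tau, (0 < tau)%R -> (s <= tau)%R ->
    (s <= eps * (rate_const + d%:R / 2 * (ln tau - ln eps)))%R) ->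
  (rate_lower * eps <= s <= rate_upper * eps)%R.
Proof.
move=> eps0 s0 hs.
have dR0 : (0 < d%:R :> R)%R by rewrite ltr0n.
have lower : (rate_lower * eps <= s)%R.
  rewrite leNgt; apply/negP => slt.
  have t0 : (0 < rate_lower * eps)%R by rewrite mulr_gt0// rate_lower_gt0.
  have := hs _ t0 (ltW slt).
  rewrite lnM ?posrE ?rate_lower_gt0// addrK /rate_lower expRK.
  rewrite (_ : d%:R / 2 * _ = - (`|rate_const| + 1))%R; last by field; rewrite gt_eqF.
  have := ler_norm rate_const.
  move=> h1 h2; have : (s <= eps * -1)%R.
    by apply: le_trans h2 _; rewrite ler_pM2l//; lra.
  by rewrite mulrN1; lra.
rewrite lower/=.
have sgt0 : (0 < s)%R by apply: lt_le_trans lower; rewrite mulr_gt0// rate_lower_gt0.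
have := hs s sgt0 (lexx _).
have r0 : (0 < s / eps)%R by rewrite divr_gt0.
rewrite -ln_div// -[X in (X <= _)%R -> _](divfK (lt0r_neq0 eps0)) mulrC ler_pM2l// => h.
rewrite -ler_pdivrMr//.
have rd0 : (0 < s / eps / d%:R)%R by rewrite divr_gt0.
have := ltW (ln_sublinear rd0); rewrite ln_div// lerBlDr => h2.
have h3 : (d%:R / 2 * ln (s / eps) <= s / eps / 2 + d%:R / 2 * ln d%:R)%R.
  apply: (@le_trans _ _ (d%:R / 2 * (s / eps / d%:R + ln d%:R))%R).
    by rewrite ler_wpM2l// divr_ge0// ltW.
  rewrite mulrDr lerD2r le_eqVlt; apply/orP; left; apply/eqP.
  by field; rewrite !gt_eqF.
have := ler_norm rate_const; have := rate_lower_gt0.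
rewrite /rate_upper; lra.
Qed.

(** With [z = eps ^ (-1/2)] and [m] its integer part, [m <= z < m + 1]; since [z >= 1], moreover
    [2 * (m + 1) <= 4 * z]. *)
Lemma grid_size (eps : R) : (0 < eps <= 1)%R -> exists m : nat,
  (m.+1%:R ^- 2 <= eps)%R /\ (ln (2 * m.+1%:R) <= ln 4 - 2^-1 * ln eps :> R)%R.
Proof.
move=> /andP[eps0 eps1].
pose z : R := Num.sqrt eps^-1.
have z1 : (1 <= z)%R.
  by rewrite -[leLHS]sqrtr1 ler_wsqrtr// invf_ge1.
have zz : (z ^+ 2 = eps^-1)%R by rewrite sqr_sqrtr// invr_ge0 ltW.
exists (Num.truncn z).
have /andP[t1 t2] := truncn_itv (le_trans ler01 z1); split.
  rewrite -[leRHS]invrK -zz lef_pV2 ?posrE ?exprn_gt0//; last by lra.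
  by rewrite ler_sqr ?nnegrE; lra.
have lz : (ln z = - (2^-1 * ln eps))%R.
  by rewrite /z -powR12_sqrt ?invr_ge0 ?ltW// ln_powR lnV ?posrE// mulrN.
rewrite -lz -lnM ?posrE//; last by lra.
by rewrite ler_ln ?posrE ?mulr_gt0//; rewrite -?natr1; lra.
Qed.

End rate_constants.

Section minimizers.
Context {R : realType} {d : nat}.
Local Notation E := 'rV[R]_d.
Local Notation T := (E * E)%type.
Local Notation c := (@quadratic_cost R d).

Lemma eot_minimizer0_le (mu0 mu1 : probability E R) (gamma : probability T R) :
  eot_minimizer c mu0 mu1 0 gamma -> forall gamma', couplings mu0 mu1 gamma' ->
  transport_cost c gamma <= transport_cost c gamma'.
Proof.
move=> [_ gmin] gamma' cg'.
have f0 g : eot_functional c 0 g = transport_cost c g.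
  by rewrite /eot_functional mul0e adde0.
by rewrite -[leLHS]f0 gmin -[leRHS]f0; apply: ereal_inf_lbound; exists gamma'.
Qed.

Lemma minimizer_rates (delta M0 M1 H0 H1 c0 eps : R) (mu0 mu1 : probability E R)
    (gamma0 gamma : probability T R) :
  (0 < d)%N -> (0 < delta)%R ->
  mu0 `<< lebesgue_rV R d -> mu1 `<< lebesgue_rV R d ->
  moment (2 + delta)%R mu0 = M0%:E -> moment (2 + delta)%R mu1 = M1%:E ->
  entropy (lebesgue_rV R d) mu0 = H0%:E ->
  entropy (lebesgue_rV R d) mu1 = H1%:E ->
  couplings mu0 mu1 gamma0 -> transport_cost c gamma0 = c0%:E ->
  (forall gamma', couplings mu0 mu1 gamma' -> c0%:E <= transport_cost c gamma') ->
  (0 < eps <= 1)%R -> eot_minimizer c mu0 mu1 eps gamma ->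
  exists s h : R,
    [/\ transport_cost c gamma = (c0 + s)%:E,
      entropy (lebesgue_rV2 R d) gamma = h%:E,
      (rate_lower d delta M0 M1 H0 H1 * eps <= s <= rate_upper d delta M0 M1 H0 H1 * eps)%R &
      (`|h + d%:R / 2 * ln eps| <= entropy_const d delta M0 M1 H0 H1)%R].
Proof.
move=> d0 delta0 mu0l mu1l hM0 hM1 eH0 eH1 cg0 hc0 opt eps01 [cg gmin].
have /andP[eps0 eps1] := eps01.
have hK0 := second_moment_le delta0 hM0; have hK1 := second_moment_le delta0 hM1.
have cfin : transport_cost c gamma \is a fin_num.
  exact: integrable_fin_num (integrable_quadratic_cost cg hK0 hK1).
pose s := (fine (transport_cost c gamma) - c0)%R.
have sE : transport_cost c gamma = (c0 + s)%:E by rewrite /s subrKC fineK.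
have s0 : (0 <= s)%R by have := opt _ cg; rewrite sE lee_fin lerDl.
have lower tau (tau0 : (0 < tau)%R) (st : (s <= tau)%R) :=
  entropy_coupling_lower cg0 hc0 opt hK0 hK1 cg sE tau0 st.
have [m [m1 m2]] := grid_size eps01.
have [gamma' [cg' cost' ent']] := competitor delta0 cg0 hM0 hM1 mu0l mu1l eH0 eH1 hc0 m.
have optE : transport_cost c gamma + eps%:E * entropy (lebesgue_rV2 R d) gamma <=
    transport_cost c gamma' + eps%:E * entropy (lebesgue_rV2 R d) gamma'.
  rewrite -/(eot_functional c eps gamma) gmin; apply: ereal_inf_lbound.
  by exists gamma'.
set W := grid_weight_const _ _ in cost'.
have W0 : (0 <= W)%R.
  rewrite /W /grid_weight_const mulr_ge0 ?mulr_ge0 ?powR_ge0//.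
  by rewrite addr_ge0 ?addr_ge0// ?(moment_ge0 hM0)// (moment_ge0 hM1).
pose B := competitor_const d delta M0 M1 H0 H1.
have up : transport_cost c gamma + eps%:E * entropy (lebesgue_rV2 R d) gamma <=
    (c0 + eps * (B - d%:R / 2 * ln eps))%:E.
  apply: le_trans optE _.
  apply: (@le_trans _ _ ((c0 + eps * (W / delta ^+ 2))%:E +
      eps%:E * (H0 + H1 + d%:R * (ln 4 - 2^-1 * ln eps))%:E)).
    apply: leeD.
      apply: le_trans cost' _; rewrite lee_fin lerD2l.
      rewrite (_ : _ / 4 * W = m.+1%:R ^- 2 * (W / delta ^+ 2))%R; last first.
        by field; rewrite (addrC 1%R) natr1 pnatr_eq0 gt_eqF.
      by rewrite ler_wpM2r// divr_ge0// exprn_ge0// ltW.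
    rewrite lee_pmul2l// ?lte_fin//; apply: le_trans ent' _.
    by rewrite lee_fin lerD2l ler_wpM2l.
  rewrite -EFinM -EFinD lee_fin le_eqVlt; apply/orP; left; apply/eqP.
  by rewrite /B /competitor_const -/W; field; rewrite gt_eqF.
(* The comparison with the competitor excludes [+oo], and the lower bound at [tau = s + 1] excludes
   [-oo]. *)
have [h hE] : exists h : R, entropy (lebesgue_rV2 R d) gamma = h%:E.
  have s1 : (0 < s + 1)%R by rewrite ltr_pwDr.
  have := lower _ s1; rewrite lerDl ler01 => /(_ isT).
  move: up; rewrite sE; case: (entropy _ _) => [h| |]; first by exists h.
  - by rewrite gt0_muley ?lte_fin// addey// leye_eq.
  - by rewrite leeNy_eq.
rewrite sE hE -EFinM -EFinD lee_fin in up.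
have lowerh tau : (0 < tau)%R -> (s <= tau)%R ->
    (- (d%:R / 2 * ln tau) - @entropy_lower_const R d ((1 + M0) + (1 + M1)) <= h)%R.
  by move=> tau0 st; rewrite -lee_fin -hE; exact: lower.
have rates : (rate_lower d delta M0 M1 H0 H1 * eps <= s <=
    rate_upper d delta M0 M1 H0 H1 * eps)%R.
  apply: rate_bounds => // tau tau0 st.
  have := lowerh tau tau0 st; rewrite -(ler_pM2l eps0).
  rewrite /rate_const -/B; move: up; move: (ln tau) (ln eps) (entropy_lower_const _) => x y z.
  rewrite !mulrBr !mulrDr !mulrN; lra.
exists s, h; split => //.
have /andP[rl ru] := rates.
have rl0 : (0 < rate_lower d delta M0 M1 H0 H1)%R by exact: rate_lower_gt0.
have ru0 : (0 < rate_upper d delta M0 M1 H0 H1)%R.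
  exact: lt_le_trans rl0 (rate_lower_upper _ _ _ _ _ d0).
have rue : (0 < rate_upper d delta M0 M1 H0 H1 * eps)%R by rewrite mulr_gt0.
(* The upper rate just proved makes [tau = rate_upper * eps] admissible, so [ln tau] is [ln eps] up
   to a constant; [hup] then uses only [s >= 0]. *)
have := lowerh _ rue ru; rewrite lnM ?posrE// => low.
have hup : (h <= B - d%:R / 2 * ln eps)%R.
  by rewrite -(ler_pM2l eps0); move: up; lra.
rewrite /entropy_const -/B; move: low.
have := ler_norm (@entropy_lower_const R d ((1 + M0) + (1 + M1)));
have := normr_ge0 (@entropy_lower_const R d ((1 + M0) + (1 + M1))).
move: (entropy_lower_const _) => z z0 z1.
have := ler_norm B; have := normr_ge0 B => B0 B1.
set L := ln (rate_upper _ _ _ _ _ _).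
have dL : (d%:R / 2 * L <= d%:R / 2 * `|L|)%R.
  by rewrite ler_wpM2l ?divr_ge0// ler_norm.
have dL0 : (0 <= d%:R / 2 * `|L|)%R by rewrite mulr_ge0 ?divr_ge0.
by rewrite mulrDr => low; rewrite ler_norml; apply/andP; split; lra.
Qed.

End minimizers.

Theorem theorem3p7 (R : realType) (d : nat) (hd : (0 < d)%N)
    (delta : R) (hdelta : (0 < delta)%R) (M0 M1 H0 H1 : R) :
  exists a b : R, [/\ (0 < a)%R, (0 < b)%R &
    forall (mu0 mu1 : probability 'rV[R]_d R)
      (gamma : R -> probability ('rV[R]_d * 'rV[R]_d)%type R),
    mu0 `<< lebesgue_rV R d -> mu1 `<< lebesgue_rV R d ->
    moment (2 + delta)%R mu0 = M0%:E -> moment (2 + delta)%R mu1 = M1%:E ->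
    entropy (lebesgue_rV R d) mu0 = H0%:E ->
    entropy (lebesgue_rV R d) mu1 = H1%:E ->
    (forall eps : R, (0 <= eps)%R ->
      eot_minimizer (@quadratic_cost R d) mu0 mu1 eps (gamma eps)) ->
    let cost (eps : R) := transport_cost (@quadratic_cost R d) (gamma eps) in
    let OT := eot_value (@quadratic_cost R d) mu0 mu1 in
    [/\ is_Theta0 (fun eps => cost eps - cost 0%R) id,
        is_O0 (fun eps => entropy (lebesgue_rV2 R d) (gamma eps)
                          - (- (d%:R / 2) * ln eps)%:E) (fun=> 1%R),
        is_O0 (fun eps => OT eps - (OT 0%R - (d%:R * eps / 2 * ln eps)%:E)) id,
        \forall eps \near (0:R)^'+,
          (a * eps)%:E <= cost eps - cost 0%R <= (b * eps)%:E
      & forall phi psi : 'rV[R]_d -> R,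
        kantorovich_potentials (@quadratic_cost R d) mu0 mu1 phi psi ->
        \forall eps \near (0:R)^'+,
          [/\ (a * eps)%:E <= \int[gamma eps]_p
                (duality_gap (@quadratic_cost R d) phi psi p.1 p.2)%:E,
              \int[gamma eps]_p
                (duality_gap (@quadratic_cost R d) phi psi p.1 p.2)%:E
                = cost eps - cost 0%R
            & cost eps - cost 0%R <= (b * eps)%:E]]].

Proof.
(* Chosen before the measures are introduced; the rates below hold for all [eps] in [(0, 1]]. *)
pose a := rate_lower d delta M0 M1 H0 H1.
pose b := rate_upper d delta M0 M1 H0 H1.
have a0 : (0 < a)%R by exact: rate_lower_gt0.
have ab : (a <= b)%R by exact: rate_lower_upper.
exists a, b; split => //; first exact: lt_le_trans ab.
move=> mu0 mu1 gamma mu0l mu1l hM0 hM1 eH0 eH1 gmin cost OT.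
have [cg0 gmin0] := gmin _ (lexx 0%R).
have hK0 := second_moment_le hdelta hM0; have hK1 := second_moment_le hdelta hM1.
have cfin : cost 0%R \is a fin_num.
  exact: integrable_fin_num (integrable_quadratic_cost cg0 hK0 hK1).
pose c0 := fine (cost 0%R).
have hc0 : cost 0%R = c0%:E by rewrite fineK.
have opt gamma' : couplings mu0 mu1 gamma' ->
    c0%:E <= transport_cost (@quadratic_cost R d) gamma'.
  by rewrite -hc0; exact: (eot_minimizer0_le (gmin _ (lexx 0%R))).
have rates eps : (0 < eps <= 1)%R -> exists s h : R,
    [/\ cost eps = (c0 + s)%:E, entropy (lebesgue_rV2 R d) (gamma eps) = h%:E,
      (a * eps <= s <= b * eps)%R &
      (`|h + d%:R / 2 * ln eps| <= entropy_const d delta M0 M1 H0 H1)%R].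
  move=> eps01; apply: (@minimizer_rates _ _ delta M0 M1 H0 H1 c0 eps mu0 mu1 (gamma 0%R)) => //.
  by apply: gmin; have /andP[/ltW] := eps01.
have near01 : \forall eps \near (0:R)^'+, (0 < eps <= 1)%R.
  near=> eps; apply/andP; split; first by near: eps; exact: nbhs_right_gt.
  by near: eps; exact: nbhs_right_le.
have OT0 : OT 0%R = c0%:E.
  by rewrite /OT -gmin0 /eot_functional mul0e adde0.
have cost_rates : \forall eps \near (0:R)^'+,
    (a * eps)%:E <= cost eps - cost 0%R <= (b * eps)%:E.
  apply: filterS near01 => eps /rates[s [h [-> _ sab _]]].
  by rewrite hc0 -EFinB addrAC subrr add0r !lee_fin.
split => //.
- by exists a, b.
- exists (entropy_const d delta M0 M1 H0 H1).
  apply: filterS near01 => eps /rates[s [h [_ -> _ hC]]].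
  by rewrite -EFinB mulNr opprK abse_EFin lee_fin normr1 mulr1.
- exists (b + entropy_const d delta M0 M1 H0 H1)%R.
  apply: filterS near01 => eps eps01; have /andP[eps0 _] := eps01.
  have [s [h [cE hE /andP[sa sb] hC]]] := rates eps eps01.
  have [_ gE] := gmin eps (ltW eps0).
  rewrite OT0 /OT -gE /eot_functional -/(cost eps) cE hE -EFinM -EFinD abse_EFin lee_fin.
  (* The logarithm in the value is exactly the one in the entropy; both remaining terms are
     [O(eps)]. *)
  have -> : (c0 + s + eps * h - (c0 - d%:R * eps / 2 * ln eps) =
      s + eps * (h + d%:R / 2 * ln eps))%R by field.
  rewrite /= (gtr0_norm eps0) mulrDl.
  apply: le_trans (ler_normD _ _) _; apply: lerD.
    by rewrite ger0_norm// (le_trans _ sa)// mulr_ge0// ltW.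
  by rewrite normrM (gtr0_norm eps0) mulrC ler_pM2r.
- move=> phi psi kp.
  have dual := optimal_dual_value cg0 hc0 opt kp.
  have [_ adm _ _ _] := kp.
  apply: filterS2 near01 cost_rates => eps /andP[eps0 _] /andP[ca cb].
  have [cg _] := gmin eps (ltW eps0).
  have [_ gapE] := duality_gap_integral cg (integrable_quadratic_cost cg hK0 hK1) adm.
  by rewrite gapE dual -hc0.
Unshelve. all: by end_near.
Qed.
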